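(* Let $\{\widetilde{\mathbf{x}}(t)\}_{t\ge 0}$ be the sequence in $\mathbb{R}^{N^2}$ generated by the $\mathcal{CIRFE}$ recursion $$\widetilde{\mathbf{x}}(t+1)=\widetilde{\mathbf{x}}(t)-\beta_{t}\mathbf{L}_{\mathcal{P}}(t)\widetilde{\mathbf{x}}(t)+\alpha_{t}\mathcal{P}\mathbf{G}_{H}\mathbf{R}^{-1}\left(\mathbf{y}(t)-\mathbf{G}_{H}^{\top}\mathcal{P}\widetilde{\mathbf{x}}(t)\right),$$ with all objects and initialization as defined in the context. Suppose assumptions A1, A2, A3, A4, A5 and A6 listed in the context hold. Then $$\mathbb{P}_{\boldsymbol{\theta}^{\ast}}\left(\lim_{t\to\infty}\widetilde{\mathbf{x}}(t)=\mathcal{P}\left(\mathbf{1}_{N}\otimes\boldsymbol{\theta}^{\ast}\right)\right)=1.$$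
   Context: Sensing model. There are $N$ agents and a fixed unknown parameter $\boldsymbol{\theta}^{\ast}\in\mathbb{R}^{N}$. At each time $t=0,1,2,\dots$ agent $n$ observes $\mathbf{y}_{n}(t)=\mathbf{H}_{n}\boldsymbol{\theta}^{\ast}+\gamma_{n}(t)\in\mathbb{R}^{M_n}$, where $\mathbf{H}_{n}\in\mathbb{R}^{M_{n}\times N}$ is deterministic and $\{\gamma_n(t)\}_t$ is a zero-mean, temporally i.i.d. noise sequence with nonsingular covariance $\mathbf{R}_n$. The stacked noise vectors $\gamma(t)=[\gamma_1(t)^\top,\dots,\gamma_N(t)^\top]^\top$ are i.i.d. over $t$ with covariance $\mathbf{R}=\mathrm{diag}[\mathbf{R}_1,\dots,\mathbf{R}_N]$ (block diagonal). $\mathbb{P}_{\boldsymbol{\theta}^\ast},\mathbb{E}_{\boldsymbol{\theta}^\ast}$ denote probability and expectation when the true parameter is $\boldsymbol{\theta}^\ast$. Communication. $\{\mathbf{L}(t)\}_{t\ge0}$ is an i.i.d. sequence of random graph Laplacians ($\mathbf{L}=\mathbf{D}-\mathbf{A}$, degree matrix minus adjacency matrix) of simple undirected graphs on the vertex set $\{1,\dots,N\}$, independent of the noise, with mean $\overline{\mathbf{L}}$. $\lambda_2(\cdot)$ is the second smallest eigenvalue. Interest sets. $\widetilde{\mathcal{I}}_n\subseteq\{1,\dots,N\}$ is the set of indices of nonzero columns of $\mathbf{H}_n$. Each agent $n$ has an interest set $\mathcal{I}_n\subseteq\{1,\dots,N\}$; $\widetilde{\mathcal{I}}_n$ and $\mathcal{I}_n$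 are nonempty. $\mathcal{P}_{\mathcal{I}_n}\in\mathbb{R}^{N\times N}$ is the diagonal matrix with $i$-th diagonal entry $1$ if $i\in\mathcal{I}_n$ and $0$ otherwise, and $\mathcal{P}=\mathrm{diag}[\mathcal{P}_{\mathcal{I}_1},\dots,\mathcal{P}_{\mathcal{I}_N}]\in\mathbb{R}^{N^2\times N^2}$ (block diagonal). Algorithm. $\widetilde{\mathbf{x}}(t)=[\widetilde{\mathbf{x}}_1(t)^\top,\dots,\widetilde{\mathbf{x}}_N(t)^\top]^\top$ with $\widetilde{\mathbf{x}}_n(t)\in\mathbb{R}^N$: the components of $\widetilde{\mathbf{x}}_n(t)$ in $\mathcal{I}_n$ are agent $n$'s estimates of the corresponding components of $\boldsymbol{\theta}^\ast$ and the other components are zero. The initial value is deterministic with $\widetilde{\mathbf{x}}(0)=\mathcal{P}\widetilde{\mathbf{x}}(0)$. $\mathbf{y}(t)=[\mathbf{y}_1(t)^\top,\dots,\mathbf{y}_N(t)^\top]^\top$; $\mathbf{G}_H=\mathrm{diag}[\mathbf{H}_1^\top,\dots,\mathbf{H}_N^\top]$ (block diagonal). $\mathbf{L}_{\mathcal{P}}(t)\in\mathbb{R}^{N^2\times N^2}$ is the block matrix whose $(n,l)$-th $N\times N$ block is $-\mathcal{P}_{\mathcal{I}_n}\sum_{r\ne n}\mathbf{L}_{nr}(t)\mathcal{P}_{\mathcal{I}_r}$ if $n=l$, and $\mathbf{L}_{nl}(t)\mathcal{P}_{\mathcal{I}_l}\mathcal{P}_{\mathcal{I}_n}$ if $n\neq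 l$, where $\mathbf{L}_{nl}(t)$ is the scalar $(n,l)$ entry of $\mathbf{L}(t)$; $\overline{\mathbf{L}_{\mathcal{P}}}=\mathbb{E}[\mathbf{L}_{\mathcal{P}}(t)]$. The weights are $\beta_t=\beta_0/(t+1)^{\delta_1}$ and $\alpha_t=a/(t+1)$ (so $\alpha_0=a$), with $a,\beta_0>0$ and $0<\delta_1<\frac12-\frac1{2+\epsilon_1}$, $\epsilon_1$ being the constant in A1. $\mathbf{1}_N$ is the all-ones vector and $\otimes$ the Kronecker product. Assumptions. A1: there is $\epsilon_1>0$ such that $\mathbb{E}_{\boldsymbol{\theta}^\ast}[\|\gamma_n(t)\|^{2+\epsilon_1}]<\infty$ for all $n$. A2: $\mathbf{G}=\sum_{n=1}^N\mathbf{H}_n^\top\mathbf{R}_n^{-1}\mathbf{H}_n$ has full rank. A3: $\widetilde{\mathcal{I}}_n\subseteq\mathcal{I}_n$ for every $n$. A4: $\lambda_2(\overline{\mathbf{L}})>0$. A5: there is $c_1>0$ such that $\mathbf{y}^\top\left(\frac{\beta_0}{\alpha_0}\overline{\mathbf{L}_{\mathcal{P}}}+\mathcal{P}\mathbf{G}_H\mathbf{R}^{-1}\mathbf{G}_H^\top\mathcal{P}\right)\mathbf{y}\ge c_1\|\mathbf{y}\|^2$ for all $\mathbf{y}\in\mathcal{S}_P=\{\mathcal{P}\mathbf{w}:\mathbf{w}\in\mathbb{R}^{N^2}\}$. A6: $a\min\left\{\lambda_{\min}\left(\sum_{n=1}^N\mathcal{P}_{\mathcal{I}_n}\mathbf{H}_n^\top\mathbf{R}_n^{-1}\mathbf{H}_n\mathcal{P}_{\mathcal{I}_n}\right),c_1,\beta_0^{-1}\right\}\ge1$,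 with $c_1$ the constant of A5 and $\lambda_{\min}$ the smallest eigenvalue. *)

(* Defs.v *)
From HB Require Import structures.
From mathcomp Require Export all_boot all_order all_algebra.
From mathcomp Require Export all_classical all_reals all_analysis.

Set Implicit Arguments.
Unset Strict Implicit.
Unset Printing Implicit Defensive.

Import Order.TTheory GRing.Theory Num.Theory.
Export numFieldNormedType.Exports.

Local Open Scope classical_set_scope.
Local Open Scope ring_scope.

Section random_matrices.
Context {d : measure_display} {Omega : measurableType d} {R : realType}.
Variable P : probability Omega R.

(* Borel sigma-algebra of 'M[R]_(m, n), generated by the entries. *)
Definition mx_borel (m n : nat) : set_system 'M[R]_(m, n) :=
  <<s \bigcup_(ij in [set: 'I_m * 'I_n])
        preimage_set_system setT (fun A : 'M[R]_(m, n) => A ij.1 ij.2)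
                            measurable >>.

Definition random_mx m n (X : Omega -> 'M[R]_(m, n)) : Prop :=
  forall B, mx_borel B -> measurable (X @^-1` B).

Definition sigma_rv m n (X : Omega -> 'M[R]_(m, n)) : set_system Omega :=
  preimage_set_system setT X (@mx_borel m n).

Definition sigma_process m n (X : nat -> Omega -> 'M[R]_(m, n)) :
    set_system Omega :=
  <<s \bigcup_t sigma_rv (X t) >>.

Definition mutually_independent (I : choiceType) (F : I -> set_system Omega) :
    Prop :=
  forall (s : seq I) (A : I -> set Omega), uniq s ->
    (forall i, i \in s -> F i (A i)) ->
    P (\bigcap_(i in [set` s]) A i) = (\prod_(i <- s) P (A i))%E.

Definition independent2 (F G : set_system Omega) : Prop :=
  forall A B, F A -> G B -> P (A `&` B) = (P A * P B)%E.

Definition identically_distributed m n (X : nat -> Omega -> 'M[R]_(m, n)) :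
    Prop :=
  forall t B, mx_borel B -> P (X t @^-1` B) = P (X 0%N @^-1` B).

Definition iid m n (X : nat -> Omega -> 'M[R]_(m, n)) : Prop :=
  [/\ forall t, random_mx (X t),
      mutually_independent (fun t => sigma_rv (X t)) &
      identically_distributed X].

(* Stated in \bar R, so that the expectations are required to be finite. *)
Definition has_mean m n (X : Omega -> 'M[R]_(m, n)) (A : 'M[R]_(m, n)) : Prop :=
  forall i j, ('E_P[fun w => X w i j] = (A i j)%:E)%E.

Definition has_covariance n (X : Omega -> 'cV[R]_n) (C : 'M[R]_n) : Prop :=
  forall i j,
    covariance P (fun w => X w i 0) (fun w => X w j 0) = (C i j)%:E.

End random_matrices.

Section linear_algebra.
Context {R : realType}.

(* The norm that the library puts on matrices is the sup norm. *)
Definition enorm n (v : 'cV[R]_n) : R := Num.sqrt (\sum_i v i 0 ^+ 2).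

Definition quad n (A : 'M[R]_n) (v : 'cV[R]_n) : R := (v^T *m A *m v) 0 0.

(* Eigenvalues in nondecreasing order, repeated according to multiplicity;
   the default [::] is only reached if char_poly A does not split over R,
   which does not happen for symmetric A. *)
Definition eigenvalues n (A : 'M[R]_n) : seq R :=
  xget [::] [set s : seq R | sorted <=%R s /\
    char_poly A = \prod_(x <- s) ('X - x%:P)].

Definition lambda_min n (A : 'M[R]_n) : R := (eigenvalues A)`_0.

(* Second smallest eigenvalue; it is 0 if n < 2, so that 0 < lambda2 A
   entails 1 < n. *)
Definition lambda2 n (A : 'M[R]_n) : R := (eigenvalues A)`_1.

End linear_algebra.

Section graphs.
Context {R : realType} {N : nat}.

Definition degree_mx (e : rel 'I_N) : 'M[R]_N :=
  diag_mx (\row_i #|e i|%:R).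

Definition adjacency_mx (e : rel 'I_N) : 'M[R]_N := \matrix_(i, j) (e i j)%:R.

Definition is_laplacian (A : 'M[R]_N) : Prop :=
  exists e : rel 'I_N,
    [/\ symmetric e, irreflexive e & A = degree_mx e - adjacency_mx e].

End graphs.

(* R^(N^2) is represented as R^(\sum_(n < N) N), the dimension of N stacked
   blocks of size N in the library's block matrices. *)
Section model.
Context {R : realType} {N : nat}.
Variable M : 'I_N -> nat.
Variables (H : forall n : 'I_N, 'M[R]_(M n, N)).
Variables (Rc : forall n : 'I_N, 'M[R]_(M n)).
Variable I : 'I_N -> {set 'I_N}.

Definition nonzero_cols (n : 'I_N) : {set 'I_N} :=
  finset (fun i => col i (H n) != 0).

Definition proj_mx_of (A : {set 'I_N}) : 'M[R]_N :=
  diag_mx (\row_i (i \in A)%:R).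

Definition Pmx : 'M[R]_(\sum_(n < N) N) := \mxdiag_(n < N) proj_mx_of (I n).

(* \mxdiag only takes square blocks, hence the explicit off-diagonal zeros. *)
Definition GH : 'M[R]_(\sum_(n < N) N, \sum_(n < N) M n) :=
  \mxblock_(n < N, l < N) (if n == l then (H l)^T else 0).

Definition Rmx : 'M[R]_(\sum_(n < N) M n) := \mxdiag_(n < N) Rc n.

Definition Gmx : 'M[R]_N := \sum_n (H n)^T *m invmx (Rc n) *m H n.

Definition GPmx : 'M[R]_N :=
  \sum_n proj_mx_of (I n) *m (H n)^T *m invmx (Rc n) *m H n
         *m proj_mx_of (I n).

Definition LP (L : 'M[R]_N) : 'M[R]_(\sum_(n < N) N) :=
  \mxblock_(n < N, l < N)
    (if n == l
     then - (proj_mx_of (I n)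
             *m \sum_(r < N | r != n) L n r *: proj_mx_of (I r))
     else L n l *: (proj_mx_of (I l) *m proj_mx_of (I n))).

(* The Kronecker product of the all-ones vector with v: N stacked copies. *)
Definition ones_kron (v : 'cV[R]_N) : 'cV[R]_(\sum_(n < N) N) :=
  \mxcol_(n < N) v.

End model.

Section weights.
Context {R : realType}.

Definition beta_wt (beta0 delta1 : R) (t : nat) : R :=
  beta0 / (t.+1%:R `^ delta1).

Definition alpha_wt (a : R) (t : nat) : R := a / t.+1%:R.

End weights.

(* Main.v *)
From HB Require Import structures.
Require Import Defs.
From mathcomp Require Import measurable_realfun zify ring lra.

Set Implicit Arguments.
Unset Strict Implicit.
Unset Printing Implicit Defensive.

Import Order.TTheory GRing.Theory Num.Theory.

Local Open Scope classical_set_scope.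
Local Open Scope ring_scope.

(** With A_t = beta_t L_P(t) + alpha_t K, where B = P G_H R^-1 and
    K = B G_H^T P, the error e_t = x_t - P (1 (x) theta) satisfies
    e_(t+1) = (I - A_t) e_t + alpha_t B gamma_t, and A_t is symmetric positive
    semidefinite because L_P(t) is so for every graph. As soon as A_t <= I,
    |(I - A_t) v|^2 <= |v|^2 - <v, A_t v>. Two consequences follow.

    Averaging over the graph and the noise, A5 and a c1 >= 1 (from A6) give
    u_(t+1) <= (1 - 1/(t+1)) u_t + C/(t+1)^2 for u_t = E|e_t|^2, hence
    u_t = O(1/sqrt t), and in particular the u_(k^4) are summable. Since a
    Laplacian takes finitely many values, the averaging only uses the
    independence of finitely many events {L(s) = g}.

    Pathwise, |e_(t+1)| <= |e_t| + alpha_t |B gamma_t|; over the block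
    [k^4, (k+1)^4) the weights alpha_t add up to O(1/k), so the squared increase
    of |e_t| has expectation O(1/k^2), again summable. Hence e_t -> 0 almost
    surely, without any martingale argument. *)

(** * Euclidean norm and positive semidefinite matrices *)

Section euclid.
Context {R : realType}.
Implicit Types (n m : nat).

Definition dot n (u v : 'cV[R]_n) : R := (u^T *m v) 0 0.
Definition sqnorm n (v : 'cV[R]_n) : R := dot v v.

Lemma dotE n (u v : 'cV[R]_n) : dot u v = \sum_i u i 0 * v i 0.
Proof. by rewrite /dot mxE; apply: eq_bigr => i _; rewrite mxE. Qed.

Lemma dotC n (u v : 'cV[R]_n) : dot u v = dot v u.
Proof. by rewrite !dotE; apply: eq_bigr => i _; rewrite mulrC. Qed.

Lemma dotDr n (u v w : 'cV[R]_n) : dot u (v + w) = dot u v + dot u w.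
Proof. by rewrite /dot mulmxDr mxE. Qed.

Lemma dotDl n (u v w : 'cV[R]_n) : dot (v + w) u = dot v u + dot w u.
Proof. by rewrite dotC dotDr !(dotC u). Qed.

Lemma dotZr n c (u v : 'cV[R]_n) : dot u (c *: v) = c * dot u v.
Proof. by rewrite /dot -scalemxAr mxE. Qed.

Lemma dotZl n c (u v : 'cV[R]_n) : dot (c *: u) v = c * dot u v.
Proof. by rewrite dotC dotZr dotC. Qed.

Lemma sqnormE n (v : 'cV[R]_n) : sqnorm v = \sum_i v i 0 ^+ 2.
Proof. by rewrite /sqnorm dotE; apply: eq_bigr => i _; rewrite expr2. Qed.

Lemma sqnorm_ge0 n (v : 'cV[R]_n) : 0 <= sqnorm v.
Proof. by rewrite sqnormE; apply: sumr_ge0 => i _; apply: sqr_ge0. Qed.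

Lemma enorm_sqr n (v : 'cV[R]_n) : enorm v ^+ 2 = sqnorm v.
Proof. by rewrite /enorm -sqnormE sqr_sqrtr // sqnorm_ge0. Qed.

Lemma enorm_ge0 n (v : 'cV[R]_n) : 0 <= enorm v.
Proof. exact: sqrtr_ge0. Qed.

Lemma sqnorm0_eq0 n (v : 'cV[R]_n) : sqnorm v = 0 -> v = 0.
Proof.
rewrite sqnormE => /eqP; rewrite psumr_eq0; last by move=> i _; apply: sqr_ge0.
move=> /allP h; apply/matrixP => i j; rewrite ord1 mxE.
by apply/eqP; rewrite -sqrf_eq0; apply: (h i); rewrite mem_index_enum.
Qed.

Lemma sqnormD n (u v : 'cV[R]_n) :
  sqnorm (u + v) = sqnorm u + 2 * dot u v + sqnorm v.
Proof. by rewrite /sqnorm dotDr !dotDl (dotC v u); ring. Qed.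

Lemma sqnormZ n c (v : 'cV[R]_n) : sqnorm (c *: v) = c ^+ 2 * sqnorm v.
Proof. by rewrite /sqnorm dotZr dotZl; ring. Qed.

(** Cauchy-Schwarz, from expanding the squared norm of [enorm v *: u - enorm u *: v], which is
    nonnegative. The last step divides by [enorm u * enorm v], so zero norms are treated first. *)
Lemma dot_le_enorm n (u v : 'cV[R]_n) : dot u v <= enorm u * enorm v.
Proof.
have [u0|u0] := eqVneq (enorm u) 0.
  have -> : u = 0 by apply: sqnorm0_eq0; rewrite -enorm_sqr u0 expr0n.
  by rewrite /dot trmx0 mul0mx mxE mulr_ge0 ?enorm_ge0.
have up : 0 < enorm u by rewrite lt_neqAle eq_sym u0 enorm_ge0.
have := sqnorm_ge0 (enorm v *: u + - enorm u *: v).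
rewrite sqnormD !sqnormZ dotZl dotZr -!enorm_sqr => h.
have [v0|v0] := eqVneq (enorm v) 0.
  have -> : v = 0 by apply: sqnorm0_eq0; rewrite -enorm_sqr v0 expr0n.
  by rewrite /dot mulmx0 mxE mulr_ge0 ?enorm_ge0.
have vp : 0 < enorm v by rewrite lt_neqAle eq_sym v0 enorm_ge0.
rewrite -(ler_pM2l (mulr_gt0 up vp)); nra.
Qed.

Lemma enormD n (u v : 'cV[R]_n) : enorm (u + v) <= enorm u + enorm v.
Proof.
rewrite -(@ler_pXn2r _ 2) ?nnegrE ?enorm_ge0 ?addr_ge0 ?enorm_ge0 //.
rewrite enorm_sqr sqnormD -!enorm_sqr.
by have := dot_le_enorm u v; nra.
Qed.

Lemma quad_dot n (A : 'M[R]_n) v : quad A v = dot v (A *m v).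
Proof. by rewrite /quad /dot mulmxA. Qed.

Lemma quadD n (A B : 'M[R]_n) v : quad (A + B) v = quad A v + quad B v.
Proof. by rewrite !quad_dot mulmxDl dotDr. Qed.

Lemma quadZ n c (A : 'M[R]_n) v : quad (c *: A) v = c * quad A v.
Proof. by rewrite !quad_dot -scalemxAl dotZr. Qed.

Lemma quad_sum n (J : Type) (s : seq J) (A : J -> 'M[R]_n) v :
  quad (\sum_(j <- s) A j) v = \sum_(j <- s) quad (A j) v.
Proof. by rewrite /quad mulmx_sumr mulmx_suml summxE. Qed.

Lemma quad_conj n m (A : 'M[R]_n) (B : 'M[R]_(m, n)) v :
  quad (B *m A *m B^T) v = quad A (B^T *m v).
Proof. by rewrite /quad trmx_mul trmxK !mulmxA. Qed.

Definition psd n (A : 'M[R]_n) := A^T = A /\ forall v, 0 <= quad A v.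

Lemma psd_add n (A B : 'M[R]_n) : psd A -> psd B -> psd (A + B).
Proof.
move=> [sA pA] [sB pB]; split; first by rewrite linearD /= sA sB.
by move=> v; rewrite quadD addr_ge0.
Qed.

Lemma psd_scale n c (A : 'M[R]_n) : 0 <= c -> psd A -> psd (c *: A).
Proof.
move=> c0 [sA pA]; split; first by rewrite linearZ /= sA.
by move=> v; rewrite quadZ mulr_ge0.
Qed.

Lemma psd_conj n m (A : 'M[R]_n) (B : 'M[R]_(m, n)) :
  psd A -> psd (B *m A *m B^T).
Proof.
move=> [sA pA]; split; first by rewrite !trmx_mul trmxK sA mulmxA.
by move=> v; rewrite quad_conj.
Qed.

(* For a non-invertible matrix [invmx] is the identity map. *)
Lemma psd_invmx n (A : 'M[R]_n) : psd A -> psd (invmx A).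
Proof.
move=> [sA pA]; have [uA|nA] := boolP (A \in unitmx); last first.
  by rewrite /invmx (negbTE nA).
have sI : (invmx A)^T = invmx A by rewrite trmx_inv sA.
split=> // v; have -> : invmx A = invmx A *m A *m (invmx A)^T.
  by rewrite sI mulVmx // mul1mx.
by rewrite quad_conj.
Qed.

(** A crude substitute for the largest eigenvalue: it bounds the quadratic form by elementary
    means. *)
Definition mx_bound n (A : 'M[R]_n) : R := \sum_i \sum_j `|A i j|.

Lemma mx_bound_ge0 n (A : 'M[R]_n) : 0 <= mx_bound A.
Proof. by apply: sumr_ge0 => i _; apply: sumr_ge0 => j _. Qed.

Lemma quad_le_bound n (A : 'M[R]_n) v : quad A v <= mx_bound A * sqnorm v.
Proof.
rewrite quad_dot dotE mulr_suml; apply: ler_sum => i _.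
rewrite mxE mulr_sumr mulr_suml; apply: ler_sum => j _.
have hk k : v k 0 ^+ 2 <= sqnorm v.
  rewrite sqnormE (bigD1 k) //= lerDl.
  by apply: sumr_ge0 => l _; apply: sqr_ge0.
apply: le_trans (ler_norm _) _; rewrite !normrM mulrCA ler_wpM2l //.
have := hk i; have := hk j; rewrite -(real_normK (num_real (v i 0))).
rewrite -(real_normK (num_real (v j 0))).
by have := normr_ge0 (v i 0); have := normr_ge0 (v j 0); nra.
Qed.

(* Evaluating the form at [v - A v] gives |A v|^2 <= <v, A v>. *)
Lemma psd_contract n (A : 'M[R]_n) v : psd A ->
  (forall u, quad A u <= sqnorm u) ->
  sqnorm (v - A *m v) <= sqnorm v - quad A v.
Proof.
move=> [sA pA] bA; have := pA (v + -1 *: (A *m v)); have := bA (A *m v).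
have e : dot (A *m v) (A *m v) = dot v (A *m (A *m v)).
  by rewrite /dot trmx_mul sA -!mulmxA.
rewrite -(scaleN1r (A *m v)) sqnormD sqnormZ !quad_dot mulmxDr -!scalemxAr.
rewrite !dotDl !dotDr !dotZl !dotZr /sqnorm -e.
by move: (dot v (A *m v)) => q; nra.
Qed.

End euclid.

(** * The network Laplacian and the projections *)

Section model_algebra.
Context {R : realType} {N : nat}.
Implicit Types (A B : {set 'I_N}).

Lemma proj_mxE A (v : 'cV[R]_N) i :
  (proj_mx_of A *m v) i 0 = (i \in A)%:R * v i 0.
Proof. by rewrite /proj_mx_of mul_diag_mx !mxE. Qed.

Lemma proj_mxC A B :
  proj_mx_of A *m proj_mx_of B = proj_mx_of B *m proj_mx_of A :> 'M[R]_N.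
Proof.
rewrite /proj_mx_of !mulmx_diag; congr diag_mx; apply/rowP=> i.
by rewrite !mxE mulrC.
Qed.

Lemma proj_mx_idem A : proj_mx_of A *m proj_mx_of A = proj_mx_of A :> 'M[R]_N.
Proof.
rewrite /proj_mx_of mulmx_diag; congr diag_mx; apply/rowP=> i; rewrite !mxE.
by case: (i \in A); rewrite ?mulr1 ?mulr0.
Qed.

Lemma tr_proj_mx A : (proj_mx_of A)^T = proj_mx_of A :> 'M[R]_N.
Proof. exact: tr_diag_mx. Qed.

Lemma dot_mxcol (p_ : 'I_N -> nat) (u v : forall n, 'cV[R]_(p_ n)) :
  dot (\mxcol_n u n) (\mxcol_n v n) = \sum_n dot (u n) (v n).
Proof. by rewrite /dot tr_mxcol mul_mxrow_mxcol summxE. Qed.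

Variable I : 'I_N -> {set 'I_N}.

Lemma Pmx_idem : Pmx I *m Pmx I = Pmx I :> 'M[R]_(\sum_(n < N) N).
Proof.
rewrite /Pmx {2 3}/mxdiag mul_mxdiag_mxblock; apply/eq_mxblock => i j.
case: eqP => [e|] /=; last by rewrite mulmx0.
by case: _ / e; rewrite !conform_mx_id proj_mx_idem.
Qed.

Lemma tr_Pmx : (Pmx I)^T = Pmx I :> 'M[R]_(\sum_(n < N) N).
Proof. by rewrite /Pmx tr_mxdiag; apply/eq_mxdiag => i; rewrite tr_proj_mx. Qed.

Definition overlap (n r : 'I_N) (i : 'I_N) : R := ((i \in I n) && (i \in I r))%:R.

(** The diagonal block of [LP] carries minus the off-diagonal entries of row [n], so it combines
    with the other blocks into differences: on component [i], only agents that share [i] exchange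
    values. The term [r = n] vanishes. *)
Lemma LP_mxcol (L : 'M[R]_N) (v : 'I_N -> 'cV[R]_N) :
  LP I L *m \mxcol_n v n =
  \mxcol_n \col_i \sum_r L n r * overlap n r i * (v r i 0 - v n i 0).
Proof.
rewrite /LP mul_mxblock_mxrow; apply/eq_mxcol => n; apply/colP => i.
rewrite mxE (bigD1 n) //= eqxx mulNmx mxE [X in X + _ = _]mxE -mulmxA proj_mxE.
rewrite mulmx_suml !summxE mulr_sumr -sumrN -big_split /=.
rewrite [RHS](bigD1 n) //= subrr mulr0 add0r; apply: eq_bigr => r rn.
rewrite eq_sym (negbTE rn) -!scalemxAl -mulmxA.
rewrite [X in _ + X = _]mxE [X in - (_ * X)]mxE !proj_mxE /overlap -mulnb natrM.
by ring.
Qed.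

Lemma Pmx_mxcol (v : 'I_N -> 'cV[R]_N) :
  Pmx I *m \mxcol_n v n = \mxcol_n (proj_mx_of (I n) *m v n).
Proof. by rewrite /Pmx mul_mxdiag_mxcol. Qed.

(** Agents that share component [i] hold the same value there after projection, so every difference
    in [LP_mxcol] is zero or weighted by zero. Hence the target is a fixed point of the consensus
    step. *)
Lemma LP_Pmx_ones (L : 'M[R]_N) (v : 'cV[R]_N) :
  LP I L *m (Pmx I *m ones_kron v) = 0.
Proof.
rewrite /ones_kron Pmx_mxcol LP_mxcol -[RHS](mxcol0 (p_ := fun=> N)).
apply/eq_mxcol => n; apply/colP => i; rewrite mxE [RHS]mxE big1 // => r _.
rewrite !proj_mxE /overlap; case: (i \in I n); case: (i \in I r) => /=;
  by rewrite ?subrr ?mulr0 ?mul0r.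
Qed.

Lemma Pmx_LP (L : 'M[R]_N) : Pmx I *m LP I L = LP I L.
Proof.
rewrite /Pmx /LP mul_mxdiag_mxblock; apply/eq_mxblock => n l.
case: eqP => _; first by rewrite mulmxN !mulmxA proj_mx_idem.
by rewrite -scalemxAr proj_mxC !mulmxA proj_mx_idem.
Qed.

Lemma laplacian_sym (L : 'M[R]_N) : is_laplacian L -> L^T = L.
Proof.
move=> [e [se ie ->]]; rewrite linearB /= tr_diag_mx; congr (_ - _).
by apply/matrixP=> i j; rewrite !mxE se.
Qed.

Lemma laplacian_offdiag (L : 'M[R]_N) i j : is_laplacian L -> i != j ->
  L i j <= 0.
Proof.
move=> [e [se ie ->]] ij; rewrite !mxE (negbTE ij) mulr0n add0r oppr_le0.
exact: ler0n.
Qed.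

(** Symmetrisation: twice the sum is the sum plus itself; exchanging [n] and [r] in one copy and
    using [L r n = L n r] turns the products into squared differences. *)
Lemma quad_LP (L : 'M[R]_N) (v : 'I_N -> 'cV[R]_N) : L^T = L ->
  2 * quad (LP I L) (\mxcol_n v n) =
  \sum_n \sum_r \sum_i - L n r * overlap n r i * (v n i 0 - v r i 0) ^+ 2.
Proof.
move=> sL; rewrite quad_dot LP_mxcol dot_mxcol.
have -> : \sum_n dot (v n)
    (\col_i \sum_r L n r * overlap n r i * (v r i 0 - v n i 0)) =
    \sum_n \sum_r \sum_i L n r * overlap n r i * (v r i 0 - v n i 0) * v n i 0.
  apply: eq_bigr => n _; rewrite dotE exchange_big /=.
  by apply: eq_bigr => i _; rewrite mxE mulrC mulr_suml.
set S := LHS; have : S = S by []; rewrite {2}/S mulr_natl mulr2n => ->.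
rewrite {2}exchange_big /= -big_split; apply: eq_bigr => n _ /=.
rewrite -big_split; apply: eq_bigr => r _ /=.
rewrite -big_split; apply: eq_bigr => i _ /=.
have -> : L r n = L n r by rewrite -{1}sL mxE.
by rewrite /overlap [(i \in I r) && _]andbC; ring.
Qed.

(** By [quad_LP] the form is a sum of squares with weights [- L n r], nonnegative off the diagonal;
    the terms [n = r] have zero difference. *)
Lemma psd_LP (L : 'M[R]_N) : is_laplacian L -> psd (LP I L).
Proof.
move=> lL; have sL := laplacian_sym lL; split.
  rewrite /LP tr_mxblock; apply/eq_mxblock => n l; rewrite eq_sym.
  case: eqP => [->|_]; last first.
    by rewrite linearZ /= trmx_mul !tr_proj_mx -{2}sL mxE.
  rewrite linearN /= trmx_mul tr_proj_mx linear_sum /=; congr (- _).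
  rewrite mulmx_suml mulmx_sumr; apply: eq_bigr => r _.
  by rewrite linearZ /= tr_proj_mx -scalemxAl -scalemxAr proj_mxC.
move=> v; rewrite -(submxcolK v) -(pmulr_rge0 _ (ltr0n R 2)) quad_LP //.
apply: sumr_ge0 => n _; apply: sumr_ge0 => r _; apply: sumr_ge0 => i _.
have [->|nr] := eqVneq n r; first by rewrite subrr expr0n mulr0.
by rewrite mulr_ge0 ?sqr_ge0 ?mulr_ge0 ?ler0n // oppr_ge0 laplacian_offdiag.
Qed.

Variable M : 'I_N -> nat.
Variables (H : forall n : 'I_N, 'M[R]_(M n, N)).

Lemma trGH_mxcol (v : 'I_N -> 'cV[R]_N) :
  (GH H)^T *m \mxcol_n v n = \mxcol_n (H n *m v n).
Proof.
rewrite /GH tr_mxblock mul_mxblock_mxrow; apply/eq_mxcol => n.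
rewrite (bigD1 n) //= eqxx trmxK big1 ?addr0 // => l ln.
by rewrite (negbTE ln) trmx0 mul0mx.
Qed.

(** A column of [H n] with index outside [I n] is zero, so the projection erases only components
    that agent [n] does not observe. *)
Lemma trGH_Pmx : (forall n, nonzero_cols H n \subset I n) ->
  (GH H)^T *m Pmx I = (GH H)^T.
Proof.
move=> hI; rewrite /GH /Pmx tr_mxblock mul_mxblock_mxdiag.
apply/eq_mxblock => n l; case: eqP => [->|_]; last by rewrite trmx0 mul0mx.
rewrite trmxK; apply/matrixP => i j; rewrite /proj_mx_of mul_mx_diag !mxE.
have [jI|jI] := boolP (j \in I n); first by rewrite mulr1.
rewrite mulr0; have : j \notin nonzero_cols H n.
  by apply: contra jI; apply: (fintype.subsetP (hI n)).
by rewrite inE negbK => /eqP/colP/(_ i); rewrite !mxE.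
Qed.

End model_algebra.

(** * Square-integrable random variables *)

Section integrals.
Context {d : measure_display} {Omega : measurableType d} {R : realType}.
Variable P : probability Omega R.
Implicit Types (X Y : Omega -> R) (A : set Omega).

Definition L1 X := P.-integrable setT (EFin \o X).

(** Measurability of [X] is a separate clause because that of its square does not imply it. *)
Definition L2 X := measurable_fun setT X /\ L1 (fun w => X w ^+ 2).

Lemma L1_measurable X : L1 X -> measurable_fun setT X.
Proof. by move=> /measurable_int /measurable_EFinP. Qed.

Lemma L1_le X Y : measurable_fun setT X -> (forall w, `|X w| <= Y w) ->
  L1 Y -> L1 X.
Proof.
move=> mX XY; apply: le_integrable => //; first exact/measurable_EFinP.
move=> w _ /=; rewrite lee_fin; apply: le_trans (XY w) _; exact: ler_norm.
Qed.

Lemma L1_fineK X : L1 X -> (\int[P]_w (X w)%:E)%E = (\int[P]_w X w)%:E.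
Proof.
move=> lX; rewrite /Rintegral fineK //.
exact: (@integrable_fin_num _ _ _ P setT measurableT _ lX).
Qed.

Lemma L1D X Y : L1 X -> L1 Y -> L1 (fun w => X w + Y w).
Proof. by move=> lX lY; exact: (integrableD measurableT lX lY). Qed.

Lemma L1Z c X : L1 X -> L1 (fun w => c * X w).
Proof. by move=> lX; exact: (integrableZl measurableT c lX). Qed.

Lemma L1_cst c : L1 (cst c).
Proof. exact: finite_measure_integrable_cst. Qed.

Lemma L1_sum (J : Type) (s : seq J) (F : J -> Omega -> R) :
  (forall j, L1 (F j)) -> L1 (fun w => \sum_(j <- s) F j w).
Proof.
move=> lF; elim: s => [|j s ih].
  by under [X in L1 X]eq_fun do rewrite big_nil; exact: L1_cst.
by under [X in L1 X]eq_fun do rewrite big_cons; apply: L1D.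
Qed.

Lemma integral_sum (J : Type) (s : seq J) (F : J -> Omega -> R) :
  (forall j, L1 (F j)) ->
  \int[P]_w (\sum_(j <- s) F j w) = \sum_(j <- s) \int[P]_w F j w.
Proof.
move=> lF; elim: s => [|j s ih].
  rewrite big_nil; under eq_Rintegral do rewrite big_nil.
  by rewrite Rintegral_cst // mul0r.
rewrite big_cons -ih; under eq_Rintegral do rewrite big_cons.
by rewrite RintegralD //; [exact: lF|exact: L1_sum].
Qed.

Lemma L2_L1M X Y : L2 X -> L2 Y -> L1 (fun w => X w * Y w).
Proof.
move=> [mX iX] [mY iY]; apply: (@L1_le _ (fun w => X w ^+ 2 + Y w ^+ 2)).
- exact: measurable_funM.
- move=> w; rewrite ler_norml; apply/andP; split; last by nra.
  by rewrite lerNl; nra.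
- exact: L1D.
Qed.

Lemma L2_cst c : L2 (cst c).
Proof. by split=> //; exact: (L1_cst (c ^+ 2)). Qed.

Lemma L2_L1 X : L2 X -> L1 X.
Proof.
move=> lX; have := L2_L1M lX (L2_cst 1).
by under [X in L1 X -> _]eq_fun do rewrite mulr1.
Qed.

Lemma L2D X Y : L2 X -> L2 Y -> L2 (fun w => X w + Y w).
Proof.
move=> lX lY; split; first by apply: measurable_funD; [case: lX|case: lY].
under [X in L1 X]eq_fun do rewrite expr2 mulrDl !mulrDr.
by apply: L1D; apply: L1D; apply: L2_L1M.
Qed.

Lemma L2_indic A X : measurable A -> L2 X -> L2 (fun w => \1_A w * X w).
Proof.
move=> mA [mX iX]; have m : measurable_fun setT (fun w => \1_A w * X w).
  exact: measurable_funM.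
split=> //; apply: L1_le iX => [|w]; first exact: measurable_funX.
rewrite exprMn normrM [`|X w ^+ 2|]ger0_norm ?sqr_ge0 // ler_piMl ?sqr_ge0 //.
by rewrite indicE; case: (_ \in _); rewrite ?expr1n ?expr0n ?normr1 ?normr0.
Qed.

Lemma L2Z c X : L2 X -> L2 (fun w => c * X w).
Proof.
move=> [mX iX]; split; first exact: measurable_funM.
by under [X in L1 X]eq_fun do rewrite exprMn; exact: L1Z.
Qed.

Lemma L2_sum (J : Type) (s : seq J) (F : J -> Omega -> R) :
  (forall j, L2 (F j)) -> L2 (fun w => \sum_(j <- s) F j w).
Proof.
move=> lF; elim: s => [|j s ih].
  by under [X in L2 X]eq_fun do rewrite big_nil; exact: L2_cst.
by under [X in L2 X]eq_fun do rewrite big_cons; apply: L2D.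
Qed.

Lemma integral_bilinear (J K : Type) (s : seq J) (r : seq K) (a : J -> R)
    (b : K -> R) (X : J -> Omega -> R) (Y : K -> Omega -> R) :
  (forall j, L2 (X j)) -> (forall k, L2 (Y k)) ->
  \int[P]_w ((\sum_(j <- s) a j * X j w) * (\sum_(k <- r) b k * Y k w)) =
  \sum_(j <- s) \sum_(k <- r) a j * b k * \int[P]_w (X j w * Y k w).
Proof.
move=> lX lY; under eq_Rintegral do rewrite big_distrlr /=.
have l j k : L1 (fun w => a j * X j w * (b k * Y k w)).
  by apply: L2_L1M; apply: L2Z.
rewrite integral_sum; last by move=> j; exact: L1_sum.
apply: eq_bigr => j _; rewrite integral_sum //; apply: eq_bigr => k _.
under eq_Rintegral do rewrite mulrACA.
by rewrite RintegralZl //; exact: L2_L1M.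
Qed.

(** Independence makes the joint law of [X] and [Y] agree with the product of their laws on
    rectangles, hence everywhere; Fubini then factors the integral. *)
Lemma integral_indep_mul X Y : L1 X -> L1 Y -> L1 (fun w => X w * Y w) ->
  (forall B C, measurable B -> measurable C ->
    P (X @^-1` B `&` Y @^-1` C) = (P (X @^-1` B) * P (Y @^-1` C))%E) ->
  \int[P]_w (X w * Y w) = (\int[P]_w X w) * (\int[P]_w Y w).
Proof.
move=> lX lY lXY ind; have mX := L1_measurable lX; have mY := L1_measurable lY.
pose hX := isMeasurableFun.Build _ _ _ _ X mX.
pose X' : {mfun Omega >-> R} := HB.pack X hX.
pose hY := isMeasurableFun.Build _ _ _ _ Y mY.
pose Y' : {mfun Omega >-> R} := HB.pack Y hY.
have mZ : measurable_fun setT (fun w => (X w, Y w)) by exact: measurable_fun_pair.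
pose hZ := isMeasurableFun.Build _ _ _ _ (fun w => (X w, Y w)) mZ.
pose Z' : {mfun Omega >-> (R * R)%type} := HB.pack (fun w => (X w, Y w)) hZ.
pose m1 := distribution P X'; pose m2 := distribution P Y'.
pose m := distribution P Z'.
have e (E : set (R * R)) : measurable E -> (m1 \x m2)%E E = m E.
  apply: product_measure_unique => B C mB mC.
  by rewrite /m1 /m2 /m /distribution /pushforward /= -ind.
pose f (p : R * R) : \bar R := (p.1 * p.2)%:E.
have mf : measurable_fun setT f.
  by apply/measurable_EFinP; apply: measurable_funM.
have i3 : m.-integrable setT f by apply: integrable_pushforward.
have i3' : (m1 \x m2)%E.-integrable setT f.
  apply/integrableP; split=> //; move/integrableP: i3 => [_ i3].
  by rewrite (eq_measure_integral m) // => E mE _; exact: e.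
have k (U : {mfun Omega >-> R}) : L1 U ->
    (distribution P U).-integrable setT EFin.
  by move=> lU; apply: integrable_pushforward.
have i (U : {mfun Omega >-> R}) : L1 U ->
    (\int[distribution P U]_x x%:E)%E = (\int[P]_w U w)%:E.
  move=> lU; rewrite integral_distribution // /Rintegral fineK //.
  exact: integrable_fin_num.
have : (\int[m]_z f z)%E = (\int[P]_w (X w * Y w))%:E.
  rewrite integral_distribution // /Rintegral fineK //.
  exact: integrable_fin_num.
rewrite -(eq_measure_integral m (D := setT) (m1 := (m1 \x m2)%E)); last first.
  by move=> E mE _; exact: e.
rewrite -integral12_prod_meas1 //.
have F x : fubini_F m2 f x = (x%:E * (\int[P]_w Y w)%:E)%E.
  by rewrite /fubini_F /f /= -(i Y' lY) -integralZl //; exact: (k Y').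
rewrite (eq_integral (fun x : R => x%:E * (\int[P]_w Y w)%:E)%E) => [|x _]; last exact: F.
rewrite integralZr //; last exact: (k X').
rewrite (i X' lX) -EFinM.
by move=> [->].
Qed.

(** The sum of the series has expectation at most [C] by monotone convergence, so it is finite
    almost surely and its terms tend to zero. *)
Lemma nonneg_series_ae_cvg0 (Z : nat -> Omega -> R) (C : R) :
  (forall k, L1 (Z k)) -> (forall k w, 0 <= Z k w) ->
  (forall n, \sum_(k < n) \int[P]_w Z k w <= C) ->
  {ae P, forall w, Z ^~ w @ \oo --> (0 : R)}.
Proof.
move=> lZ Z0 hC.
have mZ k : measurable_fun setT (EFin \o Z k).
  by apply/measurable_EFinP; exact: L1_measurable.
pose f w : \bar R := (\sum_(0 <= k <oo) (Z k w)%:E)%E.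
have mf : measurable_fun setT f.
  by apply: ge0_emeasurable_sum => [k w _ _|k _]; [rewrite lee_fin|exact: mZ].
have f0 w : (0 <= f w)%E by apply: nneseries_ge0 => k _ _; rewrite lee_fin.
have lf : P.-integrable setT f.
  apply/integrableP; split=> //; under eq_integral do rewrite gee0_abs //.
  rewrite integral_nneseries //; last by move=> k w _; rewrite lee_fin.
  apply: (@le_lt_trans _ _ C%:E); last exact: ltry.
  apply: lime_le.
    by apply: is_cvg_nneseries => k _ _; apply: integral_ge0 => w _; rewrite lee_fin.
  near=> n; rewrite big_mkord.
  apply: le_trans (_ : (\sum_(k < n) \int[P]_w Z k w)%:E <= _)%E.
    rewrite -sumEFin; apply: lee_sum => k _.
    by rewrite L1_fineK.
  by rewrite lee_fin.
have := integrable_ae measurableT lf; apply: filterS => w /(_ I) fw.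
apply: cvg_series_cvg_0; apply: nondecreasing_is_cvgn.
  by apply/nondecreasing_seqP => n; rewrite /series /= big_nat_recr //= lerDl.
exists (fine (f w)) => _ [n _ <-]; rewrite -lee_fin fineK //.
rewrite /series /= -sumEFin; apply: nneseries_lim_ge => k _ _.
by rewrite lee_fin.
Unshelve. all: by end_near. Qed.

End integrals.

(** * Events of random matrices and independence *)

Section random_matrix_events.
Context {d : measure_display} {Omega : measurableType d} {R : realType}.
Variable P : probability Omega R.

Lemma mx_borel_entry m n (i : 'I_m) (j : 'I_n) (B : set R) : measurable B ->
  mx_borel [set A : 'M[R]_(m, n) | B (A i j)].
Proof.
move=> mB; apply: sub_sigma_algebra; exists (i, j) => //.
by exists B => //; rewrite setTI.
Qed.

(** A singleton is a finite intersection of conditions on entries. This makes [L t w = g] an event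
    of the graph at time [t]. *)
Lemma mx_borel_set1 m n (g : 'M[R]_(m, n)) : mx_borel [set g].
Proof.
pose G := \bigcup_(ij in [set: 'I_m * 'I_n])
  preimage_set_system setT (fun A : 'M[R]_(m, n) => A ij.1 ij.2) measurable.
have -> : [set g] = \big[setI/setT]_(ij <- enum [set: 'I_m * 'I_n]%SET)
    [set A : 'M[R]_(m, n) | A ij.1 ij.2 = g ij.1 ij.2].
  rewrite -bigcap_seq; apply/seteqP; split=> [A -> //|A hA].
  by apply/matrixP => i j; apply: (hA (i, j)); rewrite /= mem_enum inE.
apply: (@bigsetI_measurable _ (g_sigma_algebraType G)) => ij _.
exact: (mx_borel_entry _ _ (measurable_set1 _)).
Qed.

Variables (m n : nat) (X : nat -> Omega -> 'M[R]_(m, n)).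

Lemma random_mx_entry t i j : random_mx (X t) ->
  measurable_fun setT (fun w => X t w i j).
Proof. by move=> rX _ B mB; rewrite setTI; exact: (rX _ (mx_borel_entry i j mB)). Qed.

Lemma sigma_rv_entry t i j (B : set R) : measurable B ->
  sigma_rv (X t) [set w | B (X t w i j)].
Proof.
move=> mB; exists [set A : 'M[R]_(m, n) | B (A i j)]; first exact: mx_borel_entry.
by rewrite setTI.
Qed.

Lemma sigma_rv_set1 t g : sigma_rv (X t) [set w | X t w = g].
Proof. by exists [set g]; [exact: mx_borel_set1|rewrite setTI]. Qed.

Lemma sigma_rv_process t A : sigma_rv (X t) A -> sigma_process X A.
Proof. by move=> hA; apply: sub_sigma_algebra; exists t. Qed.

Definition process_measurable (f : Omega -> R) :=
  forall B, measurable B -> sigma_process X (f @^-1` B).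

Lemma process_measurable_entry t i j : process_measurable (fun w => X t w i j).
Proof. by move=> B mB; apply: (@sigma_rv_process t); exact: sigma_rv_entry. Qed.

Lemma process_measurableM f g : process_measurable f -> process_measurable g ->
  process_measurable (fun w => f w * g w).
Proof.
pose T := g_sigma_algebraType (\bigcup_t sigma_rv (X t)).
move=> mf mg B mB.
have hf : measurable_fun (T := T) setT f by move=> _ C mC; rewrite setTI; exact: mf.
have hg : measurable_fun (T := T) setT g by move=> _ C mC; rewrite setTI; exact: mg.
by have := measurable_funM hf hg measurableT mB; rewrite setTI.
Qed.

End random_matrix_events.

(** * Integrals over events of an independent process *)

Section independence.
Context {d : measure_display} {Omega : measurableType d} {R : realType}.
Variable P : probability Omega R.

Lemma sigma_process_measurable m n (X : nat -> Omega -> 'M[R]_(m, n)) A :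
  (forall t, random_mx (X t)) -> sigma_process X A -> measurable A.
Proof.
move=> rX; apply: smallest_sub; first exact: sigma_algebra_measurable.
by move=> _ [t _ [C mC <-]]; rewrite setTI; exact: rX.
Qed.

(** The preimages under [\1_A] are the empty set, the whole space, [A] and its complement, all in
    the sigma-algebra of [X]; so independence of the processes makes [\1_A] and [f] independent. *)
Lemma integral_indep m n (X : nat -> Omega -> 'M[R]_(m, n))
    p q (Y : nat -> Omega -> 'M[R]_(p, q)) A f :
  (forall t, random_mx (X t)) ->
  independent2 P (sigma_process X) (sigma_process Y) ->
  sigma_process X A -> L1 P f -> process_measurable Y f ->
  \int[P]_w (\1_A w * f w) = fine (P A) * \int[P]_w f w.
Proof.
move=> rX ind sA lf mf; have mA := sigma_process_measurable rX sA.
have l1 : L1 P (\1_A : Omega -> R) by exact: integrable_indic.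
rewrite (integral_indep_mul (P := P) (X := \1_A)) //.
- congr (_ * _); rewrite /Rintegral.
  by rewrite integral_indic // setIT.
- apply: L1_le (_ : L1 P (fun w => `|f w|)) => [|w|].
  + by apply: measurable_funM => //; exact: L1_measurable lf.
  + rewrite normrM indicE; case: (_ \in _); rewrite ?normr1 ?normr0 ?mul1r //.
    by rewrite mul0r.
  + exact: integrable_abse lf.
- move=> B C mB mC; apply: ind; last exact: mf.
  rewrite preimage_indic; case: ifP => _; case: ifP => _ //.
  + by rewrite -setC0 -setTD; apply: sigma_algebraCD; exact: sigma_algebra0.
  + by rewrite -setTD; exact: sigma_algebraCD.
  + exact: sigma_algebra0.
Qed.

End independence.

(** * Second moments of an affine recursion driven by random graphs *)

Section future_events.
Context {d : measure_display} {Omega : measurableType d} {R : realType}.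
Variable P : probability Omega R.
Context {m n : nat}.
Variable X : nat -> Omega -> 'M[R]_(m, n).
Hypothesis X_indep : mutually_independent P (fun t => sigma_rv (X t)).

(** Finite intersections stand in for the sigma-algebra of the times from [t] on: mutual
    independence speaks of them directly, and they are closed under adding the graph of one earlier
    time. *)
Definition future (t : nat) (A : set Omega) : Prop :=
  exists (s : seq nat) (B : nat -> set Omega),
    [/\ uniq s, all (leq t) s, forall r, r \in s -> sigma_rv (X r) (B r) &
        A = \bigcap_(r in [set` s]) B r].

Lemma futureT t : future t setT.
Proof.
exists [::], (fun=> setT); split=> //.
by apply/seteqP; split=> // w _ r.
Qed.

(** All times of [A] exceed [t], so [t] can be put in front of the list without repetition; mutual
    independence for the two lists gives the factorisation. *)
Lemma future_cons t A C : future t.+1 A -> sigma_rv (X t) C ->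
  future t (A `&` C) /\ P (A `&` C) = (P A * P C)%E.
Proof.
move=> [s [B [us ls hB eA]]] hC.
have ts : t \notin s by apply/negP => /(allP ls); rewrite ltnn.
pose B' r := if r == t then C else B r.
have hB' r : r \in t :: s -> sigma_rv (X r) (B' r).
  rewrite /B' inE; case: eqP => [-> //|_] /=; exact: hB.
have BB r : r \in s -> B' r = B r.
  by move=> rs; rewrite /B'; case: eqP => // e; move: ts; rewrite -e rs.
have us' : uniq (t :: s) by rewrite /= ts.
have e : A `&` C = \bigcap_(r in [set` t :: s]) B' r.
  rewrite eA; apply/seteqP; split=> [w [hw Cw] r|w hw].
    rewrite /= inE => /orP[/eqP ->|rs]; first by rewrite /B' eqxx.
    by rewrite BB //; exact: hw.
  split; last by have := hw t; rewrite /= mem_head /B' eqxx; exact.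
  by move=> r rs; rewrite -BB //; apply: hw; rewrite /= inE (rs : r \in s) orbT.
split.
  exists (t :: s), B'; split=> //=; rewrite leqnn /=.
  by apply/allP => r /(allP ls); exact: ltnW.
rewrite e X_indep // eA X_indep // big_cons {1}/B' eqxx muleC; congr (_ * _)%E.
by rewrite big_seq [RHS]big_seq; apply: eq_bigr => r rs; rewrite BB.
Qed.

Lemma future_process t A : future t A -> sigma_process X A.
Proof.
move=> [s [B [us ls hB ->]]].
rewrite bigcap_seq big_seq.
apply: (@bigsetI_measurable _ (g_sigma_algebraType (\bigcup_t sigma_rv (X t)))).
by move=> r rs; apply: sigma_rv_process; exact: hB.
Qed.

End future_events.

(** * Evolution of the second moments *)

Section random_affine_recursion.
Context {d : measure_display} {Omega : measurableType d} {R : realType}.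
Variable P : probability Omega R.
Context {N m n : nat}.
Variables (L : nat -> Omega -> 'M[R]_N) (Gam : nat -> Omega -> 'cV[R]_m).
Hypotheses (L_iid : iid P L) (Gam_iid : iid P Gam).
Hypothesis L_Gam_indep : independent2 P (sigma_process L) (sigma_process Gam).
Hypothesis Gam_L2 : forall t j, L2 P (fun w => Gam t w j 0).
Hypothesis Gam_mean0 : forall t j, \int[P]_w Gam t w j 0 = 0.
Variable S : seq 'M[R]_N.
Hypotheses (S_uniq : uniq S) (L_S : forall t w, L t w \in S).

Definition graph_prob (g : 'M[R]_N) : R := fine (P [set w | L 0%N w = g]).

Let mL t : random_mx (L t). Proof. by case: L_iid. Qed.

Lemma measurable_graph t g : measurable [set w | L t w = g].
Proof. exact: (mL t (mx_borel_set1 g)). Qed.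

Lemma graph_probE t g : P [set w | L t w = g] = (graph_prob g)%:E.
Proof.
rewrite /graph_prob fineK ?fin_num_measure //; last exact: measurable_graph.
by case: L_iid => _ _ id_L; exact: (id_L t _ (mx_borel_set1 g)).
Qed.

Lemma graph_prob_ge0 g : 0 <= graph_prob g.
Proof. by rewrite /graph_prob fine_ge0. Qed.

Lemma noise_uncorrelated t s i j : t != s ->
  \int[P]_w (Gam t w i 0 * Gam s w j 0) = 0.
Proof.
move=> ts; rewrite integral_indep_mul ?Gam_mean0 ?mul0r //.
- exact: L2_L1.
- exact: L2_L1.
- exact: L2_L1M.
move=> B C mB mC; have [_ ind _] := Gam_iid.
pose E r := if r == t then [set w | B (Gam t w i 0)] else [set w | C (Gam s w j 0)].
have := ind [:: t; s] E; rewrite /= inE ts !big_cons big_nil mule1.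
rewrite /E eqxx eq_sym (negbTE ts) => <- //.
- congr (P _); apply/seteqP; split=> [w [wB wC] r|w hw].
    by rewrite /= !inE; case: eqP => [->|].
  split; first by have := hw t; rewrite /= !inE eqxx; exact.
  by have := hw s; rewrite /= !inE eqxx orbT eq_sym (negbTE ts); exact.
- move=> r; rewrite !inE; case: eqP => [-> _|_ /= /eqP ->].
    exact: (sigma_rv_entry Gam t i 0 mB).
  exact: (sigma_rv_entry Gam s j 0 mC).
Qed.

Lemma indic_mul (A B : set Omega) w : \1_(A `&` B) w = \1_A w * \1_B w :> R.
Proof. by rewrite indicI. Qed.

(** [S] lists every value of [L t] exactly once, so the events [L t w = g] partition the space; on
    each of them the random matrix is the constant [g]. *)
Lemma integral_split t (A : set Omega) (f : 'M[R]_N -> Omega -> R) :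
  measurable A ->
  (forall g, L1 P (fun w => \1_(A `&` [set w | L t w = g]) w * f g w)) ->
  \int[P]_w (\1_A w * f (L t w) w) =
  \sum_(g <- S) \int[P]_w (\1_(A `&` [set w | L t w = g]) w * f g w).
Proof.
move=> mA lf; rewrite -integral_sum //; apply: eq_Rintegral => w _.
rewrite (bigD1_seq (L t w)) //= indic_mul.
rewrite [\1_[set _ | _] w]indicE mem_set // mulr1 big1 ?addr0 // => g gw.
rewrite indic_mul [\1_[set _ | _] w]indicE memNset ?mulr0 ?mul0r //=.
by move=> /esym/eqP; rewrite (negbTE gw).
Qed.

Lemma graph_prob_sum (f : 'M[R]_N -> R) t :
  \int[P]_w f (L t w) = \sum_(g <- S) graph_prob g * f g.
Proof.
have := @integral_split t setT (fun g _ => f g) measurableT.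
rewrite (_ : (fun w => _) = (fun w => f (L t w))); last first.
  by apply/funext => w; rewrite indicT mul1r.
move=> ->; last first.
  move=> g; rewrite setTI; under [X in L1 _ X]eq_fun do rewrite mulrC.
  by apply: L1Z; apply: integrable_indic; exact: measurable_graph.
apply: eq_bigr => g _; rewrite setTI.
have mg := measurable_graph t g.
under eq_Rintegral do rewrite mulrC.
rewrite RintegralZl //; last exact: integrable_indic.
rewrite mulrC /Rintegral integral_indic // setIT.
by congr (_ * _); exact: (congr1 fine (graph_probE t g)).
Qed.

Variables (Mt : nat -> 'M[R]_N -> 'M[R]_n) (Bt : nat -> 'M[R]_(n, m)).
Variables (e : nat -> Omega -> 'cV[R]_n) (e0 : 'cV[R]_n).
Hypothesis e_init : forall w, e 0%N w = e0.
Hypothesis e_step : forall t w,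
  e t.+1 w = Mt t (L t w) *m e t w + Bt t *m Gam t w.

(** Stacking state and noise makes the recursion linear, [e t.+1 = W *m Z], so that state, noise and
    mixed moments are treated together. *)
Let Z t w : 'cV[R]_(n + m) := col_mx (e t w) (Gam t w).
Let W t g : 'M[R]_(n, n + m) := row_mx (Mt t g) (Bt t).

Let e_stepZ t w i : e t.+1 w i 0 = \sum_k W t (L t w) i k * Z t w k 0.
Proof. by rewrite e_step -mul_row_col mxE. Qed.

Let Z_L2 t : (forall i, L2 P (fun w => e t w i 0)) ->
  forall k, L2 P (fun w => Z t w k 0).
Proof.
move=> h k; rewrite /Z; case: (split_ordP k) => j ->.
  by under [X in L2 _ X]eq_fun do rewrite col_mxEu.
by under [X in L2 _ X]eq_fun do rewrite col_mxEd.
Qed.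

Lemma state_L2 t i : L2 P (fun w => e t w i 0).
Proof.
elim: t i => [|t ih] i.
  by under [X in L2 _ X]eq_fun do rewrite e_init; exact: L2_cst.
have -> : (fun w => e t.+1 w i 0) = (fun w => \sum_(g <- S)
    \1_[set w | L t w = g] w * \sum_k W t g i k * Z t w k 0).
  apply/funext => w; rewrite e_stepZ (bigD1_seq (L t w)) //= [X in _ + X]big1 ?addr0.
    by rewrite indicE mem_set // mul1r.
  move=> g gw; rewrite indicE memNset ?mul0r //=.
  by move=> /esym/eqP; rewrite (negbTE gw).
apply: L2_sum => g; apply: L2_indic; first exact: measurable_graph.
by apply: L2_sum => k; apply: L2Z; exact: Z_L2.
Qed.

Let fut := future L.

Let mfut t A : fut t A -> measurable A.
Proof. by move=> fA; exact: (sigma_process_measurable mL (future_process fA)). Qed.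

Let future_noise t A s i : fut t A -> \int[P]_w (\1_A w * Gam s w i 0) = 0.
Proof.
move=> fA; rewrite (integral_indep mL L_Gam_indep (future_process fA)).
- by rewrite Gam_mean0 mulr0.
- exact: L2_L1.
- exact: process_measurable_entry.
Qed.

Let future_noise2 t A s r i j : fut t A ->
  \int[P]_w (\1_A w * (Gam s w i 0 * Gam r w j 0)) =
  fine (P A) * \int[P]_w (Gam s w i 0 * Gam r w j 0).
Proof.
move=> fA; rewrite (integral_indep mL L_Gam_indep (future_process fA)) //.
- exact: L2_L1M.
- by apply: process_measurableM; exact: process_measurable_entry.
Qed.

(** The induction invariant: restricting to an event on the graphs from [t] on only scales the
    second moments of [e t] by its probability, and [e t] stays uncorrelated with the noise from [t]
    on. *)
Let moments t :=
  (forall A i j, fut t A ->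
     \int[P]_w (\1_A w * (e t w i 0 * e t w j 0)) =
     fine (P A) * \int[P]_w (e t w i 0 * e t w j 0)) /\
  (forall A s i j, fut t A -> (t <= s)%N ->
     \int[P]_w (\1_A w * (e t w i 0 * Gam s w j 0)) = 0).

Let fine_setT : fine (P setT) = 1.
Proof. by rewrite probability_setT. Qed.

Let indicTl (f : Omega -> R) :
  \int[P]_w (\1_setT w * f w) = \int[P]_w f w.
Proof. by apply: eq_Rintegral => w _; rewrite indicT mul1r. Qed.

Let state_noise0 t i s j : moments t -> (t <= s)%N ->
  \int[P]_w (e t w i 0 * Gam s w j 0) = 0.
Proof. by move=> [_ h] ts; rewrite -indicTl h //; exact: futureT. Qed.

Let Z_moments t A k l : moments t -> fut t A ->
  \int[P]_w (\1_A w * (Z t w k 0 * Z t w l 0)) =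
  fine (P A) * \int[P]_w (Z t w k 0 * Z t w l 0).
Proof.
move=> mt fA; have [h1 h2] := mt; rewrite /Z.
case: (split_ordP k) => i ->; case: (split_ordP l) => j ->.
- under eq_Rintegral do rewrite !col_mxEu.
  by under [in RHS]eq_Rintegral do rewrite !col_mxEu; exact: h1.
- under eq_Rintegral do rewrite col_mxEu col_mxEd.
  under [in RHS]eq_Rintegral do rewrite col_mxEu col_mxEd.
  by rewrite h2 // state_noise0 // mulr0.
- under eq_Rintegral do rewrite col_mxEu col_mxEd [Gam _ _ _ _ * _]mulrC.
  under [in RHS]eq_Rintegral do rewrite col_mxEu col_mxEd [Gam _ _ _ _ * _]mulrC.
  by rewrite h2 // state_noise0 // mulr0.
- under eq_Rintegral do rewrite !col_mxEd.
  by under [in RHS]eq_Rintegral do rewrite !col_mxEd; exact: (future_noise2 _ _ _ _ fA).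
Qed.

Let WZ t g i w := \sum_k W t g i k * Z t w k 0.

Let WZ_L2 t g i : L2 P (WZ t g i).
Proof. by apply: L2_sum => k; apply: L2Z; apply: Z_L2; exact: state_L2. Qed.

Let WZ_moments t A g i j : moments t -> fut t A ->
  \int[P]_w (\1_A w * (WZ t g i w * WZ t g j w)) =
  fine (P A) * \int[P]_w (WZ t g i w * WZ t g j w).
Proof.
move=> mt fA; have lZ := Z_L2 (state_L2 t); rewrite /WZ integral_bilinear //.
have -> : (fun w => \1_A w * ((\sum_k W t g i k * Z t w k 0) *
    \sum_k W t g j k * Z t w k 0)) = (fun w =>
    (\sum_k W t g i k * (\1_A w * Z t w k 0)) * \sum_k W t g j k * Z t w k 0).
  apply/funext => w; rewrite mulrA; congr (_ * _); rewrite mulr_sumr.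
  by apply: eq_bigr => k _; rewrite mulrCA.
rewrite integral_bilinear //; last first.
  by move=> k; apply: L2_indic; first exact: (mfut fA).
rewrite mulr_sumr; apply: eq_bigr => k _; rewrite mulr_sumr.
apply: eq_bigr => l _; under eq_Rintegral do rewrite -mulrA.
by rewrite Z_moments // mulrCA.
Qed.

Let fut_graph t A g : fut t.+1 A ->
  fut t (A `&` [set w | L t w = g]) /\
  fine (P (A `&` [set w | L t w = g])) = fine (P A) * graph_prob g.
Proof.
have [_ iL _] := L_iid; move=> fA.
have [h1 h2] := future_cons iL fA (sigma_rv_set1 L t g); split=> //.
have pA : P A \is a fin_num by apply: fin_num_measure; exact: mfut fA.
by rewrite h2 graph_probE fineM.
Qed.

(** Split according to the graph at time [t]. On each piece the step is a fixed linear map, and [A]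
    intersected with the piece is a future event at [t], whose probability factors by
    [fut_graph]. *)
Let moments_step t : moments t ->
  forall A i j, fut t.+1 A ->
  \int[P]_w (\1_A w * (e t.+1 w i 0 * e t.+1 w j 0)) =
  fine (P A) * \sum_(g <- S) graph_prob g * \int[P]_w (WZ t g i w * WZ t g j w).
Proof.
move=> mt A i j fA; have mA := mfut fA.
under eq_Rintegral do rewrite !e_stepZ.
rewrite (@integral_split t A (fun g w => WZ t g i w * WZ t g j w)) //.
  rewrite mulr_sumr; apply: eq_bigr => g _; have [fg pg] := fut_graph g fA.
  by rewrite WZ_moments // pg mulrA.
move=> g; under [X in L1 _ X]eq_fun do rewrite mulrA.
apply: L2_L1M; last exact: WZ_L2.
by apply: L2_indic; [exact: measurableI mA (measurable_graph t g)|exact: WZ_L2].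
Qed.

Let moments_all t : moments t.
Proof.
elim: t => [|t ih].
  split=> [A i j fA|A s i j fA _].
    have mA := mfut fA.
    under eq_Rintegral do rewrite !e_init [\1_A _ * _]mulrC.
    under [in RHS]eq_Rintegral do rewrite !e_init.
    rewrite (@RintegralZl _ _ _ P setT \1_A) //; last exact: integrable_indic.
    rewrite Rintegral_cst // [fine (P setT)]fine_setT mulr1 mulrC; congr (_ * _).
    by rewrite /Rintegral integral_indic // setIT.
  under eq_Rintegral do rewrite e_init mulrCA.
  rewrite RintegralZl // ?(future_noise s j fA) ?mulr0 //.
  apply: L2_L1; apply: L2_indic => //; exact: (mfut fA).
split=> [A i j fA|A s i j fA ts].
  rewrite moments_step //; congr (_ * _).
  by rewrite -indicTl moments_step ?fine_setT ?mul1r //; exact: futureT.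
have mA := mfut fA.
under eq_Rintegral do rewrite e_stepZ.
rewrite (@integral_split t A (fun g w => WZ t g i w * Gam s w j 0)) //; last first.
  move=> g; under [X in L1 _ X]eq_fun do rewrite mulrA.
  apply: L2_L1M; last exact: Gam_L2.
  by apply: L2_indic; [exact: measurableI mA (measurable_graph t g)|exact: WZ_L2].
rewrite big1 // => g _; have [fg pg] := fut_graph g fA.
set A' := A `&` _ in fg *.
(* The one-term second sum gives the product the shape required by [integral_bilinear]. *)
have -> : (fun w => \1_A' w * (WZ t g i w * Gam s w j 0)) = (fun w =>
    (\sum_k W t g i k * (\1_A' w * Z t w k 0)) *
    (\sum_(l <- [:: j]) 1 * Gam s w l 0)).
  apply/funext => w; rewrite mulrA big_seq1 mul1r; congr (_ * _).
  by rewrite mulr_sumr; apply: eq_bigr => k _; rewrite mulrCA.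
have lZ := Z_L2 (state_L2 t).
rewrite integral_bilinear //; last first.
  by move=> k; apply: L2_indic; first exact: (mfut fg).
rewrite big1 // => k _; rewrite big_seq1 mulr1.
under eq_Rintegral do rewrite -mulrA.
have [_ h2] := ih.
suff -> : \int[P]_w (\1_A' w * (Z t w k 0 * Gam s w j 0)) = 0 by rewrite mulr0.
(* For a state component the induction hypothesis applies, as [t <= s]; for a noise component the
   times [t] and [s] differ, so the noises are uncorrelated. *)
rewrite /Z; case: (split_ordP k) => l ->.
  by under eq_Rintegral do rewrite col_mxEu; rewrite h2 // ltnW.
under eq_Rintegral do rewrite col_mxEd.
by rewrite (future_noise2 _ _ _ _ fg) noise_uncorrelated ?mulr0 // ltn_eqF.
Qed.

Lemma graph_prob_sum1 : \sum_(g <- S) graph_prob g = 1.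
Proof.
have := graph_prob_sum (fun=> 1) 0%N.
by under eq_bigr do rewrite mulr1; rewrite Rintegral_cst // mul1r => <-.
Qed.

Lemma linear_image_L2 k (A : 'M[R]_(n, k)) (v : Omega -> 'cV[R]_k) :
  (forall j, L2 P (fun w => v w j 0)) -> forall i, L2 P (fun w => (A *m v w) i 0).
Proof.
move=> lv i; under [X in L2 _ X]eq_fun do rewrite mxE.
by apply: L2_sum => j; exact: L2Z.
Qed.

Lemma sqnorm_L1 k (v : Omega -> 'cV[R]_k) :
  (forall j, L2 P (fun w => v w j 0)) -> L1 P (fun w => sqnorm (v w)).
Proof.
move=> lv; under [X in L1 _ X]eq_fun do rewrite /sqnorm dotE.
by apply: L1_sum => j; exact: L2_L1M.
Qed.

(** The graph at [t] enters only through its probabilities by [moments_step], and for each [g] the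
    cross term vanishes because state and current noise are uncorrelated. *)
Lemma mean_sqnorm_step t :
  \int[P]_w sqnorm (e t.+1 w) =
  \sum_(g <- S) graph_prob g * \int[P]_w sqnorm (Mt t g *m e t w) +
  \int[P]_w sqnorm (Bt t *m Gam t w).
Proof.
have mt := moments_all t; have le := state_L2 t.
have lM g := linear_image_L2 (Mt t g) le.
have lB := linear_image_L2 (Bt t) (Gam_L2 t).
have cross g : \int[P]_w dot (Mt t g *m e t w) (Bt t *m Gam t w) = 0.
  under eq_Rintegral do rewrite dotE.
  rewrite integral_sum; last by move=> i; exact: L2_L1M.
  rewrite big1 // => i _; under eq_Rintegral do rewrite !mxE.
  rewrite integral_bilinear // big1 // => k _; rewrite big1 // => l _.
  by rewrite state_noise0 // mulr0.
have WZE g : \sum_i \int[P]_w (WZ t g i w * WZ t g i w) =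
    \int[P]_w sqnorm (Mt t g *m e t w) + \int[P]_w sqnorm (Bt t *m Gam t w).
  rewrite -integral_sum; last by move=> i; exact: L2_L1M.
  have -> : (fun w => \sum_i WZ t g i w * WZ t g i w) = (fun w =>
      sqnorm (Mt t g *m e t w) + (2 * dot (Mt t g *m e t w) (Bt t *m Gam t w) +
      sqnorm (Bt t *m Gam t w))).
    apply/funext => w; rewrite addrA -sqnormD -mul_row_col sqnormE.
    by apply: eq_bigr => i _; rewrite /WZ mxE expr2.
  have ld : L1 P (fun w => dot (Mt t g *m e t w) (Bt t *m Gam t w)).
    under [X in L1 _ X]eq_fun do rewrite dotE.
    by apply: L1_sum => i; exact: L2_L1M.
  rewrite RintegralD //; [|exact: sqnorm_L1|].
    rewrite RintegralD //; [|exact: L1Z|exact: sqnorm_L1].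
    by rewrite RintegralZl // cross mulr0 add0r.
  by apply: L1D; [exact: L1Z|exact: sqnorm_L1].
have -> : \int[P]_w sqnorm (e t.+1 w) =
    \sum_(g <- S) graph_prob g * \sum_i \int[P]_w (WZ t g i w * WZ t g i w).
  under eq_Rintegral do rewrite /sqnorm dotE.
  rewrite integral_sum; last by move=> i; apply: L2_L1M; exact: state_L2.
  under [RHS]eq_bigr do rewrite mulr_sumr.
  rewrite exchange_big; apply: eq_bigr => i _ /=.
  by rewrite -indicTl (moments_step mt) ?fine_setT ?mul1r //; exact: futureT.
under eq_bigr do rewrite WZE mulrDr.
by rewrite big_split /= -mulr_suml graph_prob_sum1 mul1r.
Qed.

Lemma mean_sqnorm_average t :
  \sum_(g <- S) graph_prob g * \int[P]_w sqnorm (Mt t g *m e t w) =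
  \int[P]_w (\sum_(g <- S) graph_prob g * sqnorm (Mt t g *m e t w)).
Proof.
have l g := sqnorm_L1 (linear_image_L2 (Mt t g) (state_L2 t)).
rewrite integral_sum; last by move=> g; exact: L1Z.
by apply: eq_bigr => g _; rewrite RintegralZl //; exact: l.
Qed.

End random_affine_recursion.

(** * Deterministic sequences *)

Section real_sequences.
Context {R : realType}.

Lemma sqr_sum_le (J : Type) (s : seq J) (f : J -> R) :
  (\sum_(j <- s) f j) ^+ 2 <= (size s)%:R * \sum_(j <- s) f j ^+ 2.
Proof.
elim: s => [|j s ih]; first by rewrite !big_nil expr0n mulr0.
rewrite !big_cons /= -natr1; set S := \sum_(i <- s) f i in ih *.
set Q := \sum_(i <- s) f i ^+ 2 in ih *; set n : R := (size s)%:R in ih *.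
have Q0 : 0 <= Q by apply: sumr_ge0 => i _; exact: sqr_ge0.
have n0 : 0 <= n by exact: ler0n.
suff : 2 * f j * S <= n * f j ^+ 2 + Q by nra.
have h0 : 0 <= n * f j ^+ 2 + Q by rewrite addr_ge0 // mulr_ge0 // sqr_ge0.
(* Compare squares: by [S ^+ 2 <= n * Q] it remains to see [4 x Q <= (x + Q) ^ 2] with
   [x = n * f j ^+ 2]. *)
apply: le_trans (ler_norm _) _; rewrite -(@ler_pXn2r _ 2) ?nnegrE //.
rewrite real_normK ?num_real //.
have : f j ^+ 2 * S ^+ 2 <= f j ^+ 2 * (n * Q) by rewrite ler_wpM2l ?sqr_ge0.
by have := sqr_ge0 (n * f j ^+ 2 - Q); nra.
Qed.

(** With [p] and [q] the two roots, [(p - q) * (p + q) = 1], while [p + q <= 2 * p <= 2 * p ^+ 2].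
    Summed over [t], this bounds harmonic sums by a square root. *)
Lemma inv_le_sqrt_diff (t : nat) :
  t.+1%:R^-1 <= 2 * (Num.sqrt t.+1%:R - Num.sqrt t%:R) :> R.
Proof.
set p : R := Num.sqrt t.+1%:R; set q : R := Num.sqrt t%:R.
have p2 : p ^+ 2 = t.+1%:R by rewrite sqr_sqrtr ?ler0n.
have q2 : q ^+ 2 = t%:R by rewrite sqr_sqrtr ?ler0n.
have q0 : 0 <= q by exact: sqrtr_ge0.
have p1 : 1 <= p by rewrite -[1](sqrtr1 R) ler_wsqrtr // ler1n.
have d1 : p ^+ 2 = q ^+ 2 + 1 by rewrite p2 q2 natr1.
rewrite -p2 -[_^-1]mul1r ler_pdivrMr ?exprn_gt0 ?(lt_le_trans ltr01) //.
have qp : q <= p by rewrite ler_wsqrtr // ler_nat.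
have h : (p - q) * (p + q) = 1 by rewrite -subr_sqr d1; ring.
have h2 : (p - q) * (p + q) <= (p - q) * (2 * p) by apply: ler_wpM2l; lra.
have h3 : (p - q) * (2 * p) * 1 <= (p - q) * (2 * p) * p.
  by apply: ler_wpM2l => //; apply: mulr_ge0; lra.
lra.
Qed.

(** Multiplying the recursion by [t + 1] gives [(t + 1) u_(t+1) <= t u_t + C / (t + 1)], which
    telescopes with [inv_le_sqrt_diff]. *)
Lemma contraction_rate (u : nat -> R) (C : R) (T : nat) : 0 <= C ->
  (forall t, (T <= t)%N ->
    u t.+1 <= (1 - t.+1%:R^-1) * u t + C / t.+1%:R ^+ 2) ->
  forall s, (T + s)%:R * u (T + s)%N <=
    T%:R * u T + 2 * C * Num.sqrt (T + s)%:R.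
Proof.
move=> C0 h; elim=> [|s ih].
  by rewrite addn0 lerDl mulr_ge0 ?sqrtr_ge0 ?mulr_ge0.
have := h (T + s)%N (leq_addr _ _); have := inv_le_sqrt_diff (T + s).
rewrite addnS; move: ih; set t := (T + s)%N => ih hs hu.
have tp : 0 < t.+1%:R :> R by rewrite ltr0n.
have : t.+1%:R * u t.+1 <= t%:R * u t + C * t.+1%:R^-1.
  apply: le_trans (ler_wpM2l (ltW tp) hu) _; rewrite -natr1 in tp *.
  by rewrite le_eqVlt; apply/orP; left; apply/eqP; field; apply: lt0r_neq0.
have := ler_wpM2l C0 hs; move: ih.
move: (t.+1%:R * _) (t%:R * _) (T%:R * _) (Num.sqrt _) (Num.sqrt _) (_^-1).
by move=> *; lra.
Qed.

(** At time [k ^ 4] the root in [contraction_rate] is [k ^ 2]; dividing by [k ^ 4] leaves the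
    summable order [1 / k ^ 2]. *)
Lemma contraction_rate4 (u : nat -> R) (C : R) (T : nat) : 0 <= C -> 0 <= u T ->
  (forall t, (T <= t)%N ->
    u t.+1 <= (1 - t.+1%:R^-1) * u t + C / t.+1%:R ^+ 2) ->
  forall k, (0 < k)%N -> (T <= k)%N ->
    u (k ^ 4)%N <= (T%:R * u T + 2 * C) / k%:R ^+ 2.
Proof.
move=> C0 u0 h k k0 Tk.
have Tk4 : (T <= k ^ 4)%N by apply: leq_trans Tk _; rewrite -{1}(expn1 k) leq_pexp2l.
have := contraction_rate C0 h (k ^ 4 - T)%N; rewrite subnKC //.
have -> : Num.sqrt (k ^ 4)%:R = k%:R ^+ 2 :> R.
  rewrite natrX (_ : k%:R ^+ 4 = (k%:R ^+ 2) ^+ 2); last by rewrite -exprM.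
  by rewrite sqrtr_sqr ger0_norm ?exprn_ge0.
rewrite natrX; set K : R := k%:R.
have K1 : 1 <= K by rewrite ler1n.
move=> hk; rewrite ler_pdivlMr ?exprn_gt0 ?(lt_le_trans ltr01) //.
have K2 : 1 <= K ^+ 2 by rewrite exprn_ege1.
have K2p : 0 < K ^+ 2 by lra.
rewrite -(ler_pM2r K2p) -mulrA -exprD mulrC.
apply: le_trans hk _; have := ler0n R T => T0.
have : T%:R * u T * 1 <= T%:R * u T * K ^+ 2 by rewrite ler_wpM2l ?mulr_ge0.
lra.
Qed.

Lemma sum_inv_sqr_le (n : nat) : \sum_(k < n) k.+2%:R ^- 2 <= 1 :> R.
Proof.
(* The sharper bound telescopes: [1 / (k + 2) ^ 2 <= 1 / (k + 1) - 1 / (k + 2)]. *)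
suff : \sum_(k < n) k.+2%:R ^- 2 <= 1 - n.+1%:R^-1 :> R.
  by move=> h; apply: le_trans h _; rewrite gerBl invr_ge0.
elim: n => [|n ih]; first by rewrite big_ord0 invr1 subrr.
rewrite big_ord_recr /=; apply: le_trans (lerD ih (lexx _)) _.
have n0 : 0 <= n%:R :> R by exact: ler0n.
rewrite -addrA lerD2l -(natr1 n.+1) -(natr1 n).
set x : R := n%:R in n0 *.
rewrite -subr_ge0 (_ : _ - _ = (x + 1)^-1 * (x + 1 + 1)^-2); last first.
  by field; lra.
by rewrite mulr_ge0 // invr_ge0; rewrite ?exprn_ge0; lra.
Qed.

Lemma fourth_power_block (t : nat) : exists k, (k ^ 4 <= t < k.+1 ^ 4)%N.
Proof.
elim: t => [|t [k /andP[h1 h2]]]; first by exists 0%N.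
have [e|ne] := eqVneq t.+1 (k.+1 ^ 4)%N.
  by exists k.+1; rewrite -e leqnn /= e ltn_exp2r.
by exists k; rewrite (leqW h1) ltn_neqAle ne.
Qed.

(** The squared value at the start of the block plus the Cauchy-Schwarz bound for the squared total
    increase over it. Unlike the square of the sum, it is linear in the squares, so its expectation
    is immediate. *)
Definition block_energy (alpha b r : nat -> R) (k : nat) : R :=
  r (k ^ 4)%N ^+ 2 +
  (k.+1 ^ 4 - k ^ 4)%:R * \sum_(k ^ 4 <= s < k.+1 ^ 4) (alpha s * b s) ^+ 2.

(** Adding up increments gives [r t <= r (k ^ 4) + W]; then [(r + W) ^ 2 <= 2 r ^ 2 + 2 W ^ 2] and
    [sqr_sum_le] bounds [W]. *)
Lemma block_bound (alpha b r : nat -> R) (T k t : nat) :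
  (forall s, 0 <= alpha s * b s) -> (forall s, 0 <= r s) ->
  (forall s, (T <= s)%N -> r s.+1 <= r s + alpha s * b s) ->
  (T <= k ^ 4)%N -> (k ^ 4 <= t < k.+1 ^ 4)%N ->
  r t ^+ 2 <= 2 * block_energy alpha b r k.
Proof.
move=> ab0 r0 hr Tk /andP[kt tk]; rewrite /block_energy.
have step n : r (k ^ 4 + n)%N <=
    r (k ^ 4)%N + \sum_(k ^ 4 <= s < k ^ 4 + n) alpha s * b s.
  elim: n => [|n ih]; first by rewrite addn0 big_geq // addr0.
  rewrite addnS big_nat_recr ?leq_addr //=.
  by apply: le_trans (hr _ (leq_trans Tk (leq_addr _ _))) _; lra.
have := step (t - k ^ 4)%N; rewrite subnKC // => ht.
set W := \sum_(k ^ 4 <= s < k.+1 ^ 4) alpha s * b s.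
have sW : \sum_(k ^ 4 <= s < t) alpha s * b s <= W.
  by rewrite /W (big_cat_nat kt (ltnW tk)) /= lerDl; apply: sumr_ge0.
have hW : W ^+ 2 <= (k.+1 ^ 4 - k ^ 4)%:R *
    \sum_(k ^ 4 <= s < k.+1 ^ 4) (alpha s * b s) ^+ 2.
  by have := sqr_sum_le (index_iota (k ^ 4) (k.+1 ^ 4)) (fun s => alpha s * b s);
    rewrite size_iota.
have hrW : r t <= r (k ^ 4)%N + W by lra.
have : r t ^+ 2 <= (r (k ^ 4)%N + W) ^+ 2.
  by rewrite ler_pXn2r ?nnegrE //; apply: le_trans hrW.
by have := sqr_ge0 (r (k ^ 4)%N - W); nra.
Qed.

(** Late times lie in late blocks, so [block_bound] transfers the convergence. The shift by [T] puts
    every block after time [T]; the shift by 2 matches [sum_inv_sqr_le]. *)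
Lemma block_cvg0 (alpha b r : nat -> R) (T : nat) :
  (forall s, 0 <= alpha s * b s) -> (forall s, 0 <= r s) ->
  (forall s, (T <= s)%N -> r s.+1 <= r s + alpha s * b s) ->
  (fun k => block_energy alpha b r (k + T).+2) @ \oo --> (0 : R) ->
  (fun t => r t ^+ 2) @ \oo --> (0 : R).
Proof.
move=> ab0 r0 hr /cvgr0Pnorm_lt hZ; apply/cvgr0Pnorm_lt => eps eps0.
have eps2 : 0 < eps / 2 by lra.
have [K _ hK] := hZ _ eps2.
exists ((K + T).+2 ^ 4)%N => // t /= ht.
have [k hk] := fourth_power_block t.
have Kk : ((K + T).+2 <= k)%N.
  rewrite -ltnS -(@ltn_exp2r _ _ 4) //.
  by apply: leq_ltn_trans ht _; case/andP: hk.
have ek : k = ((k - T - 2) + T).+2 by lia.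
have := hK (k - T - 2)%N; rewrite /= -ek => /(_ ltac:(lia)) hZk.
have Tk : (T <= k ^ 4)%N.
  by apply: (@leq_trans k); [lia|rewrite -{1}(expn1 k) leq_pexp2l //; lia].
have := block_bound ab0 r0 hr Tk hk.
rewrite ger0_norm ?sqr_ge0 //; have := ler_norm (block_energy alpha b r k).
lra.
Qed.

Lemma block_length_le (k : nat) : (0 < k)%N ->
  (k.+1 ^ 4 - k ^ 4 <= 15 * k ^ 3)%N.
Proof. by move=> k0; rewrite !expnS expn0; nia. Qed.

End real_sequences.

(** * Almost sure convergence of the recursion *)

Section stochastic_approximation.
Context {d : measure_display} {Omega : measurableType d} {R : realType}.
Variable P : probability Omega R.
Context {N m n : nat}.
Variables (L : nat -> Omega -> 'M[R]_N) (Gam : nat -> Omega -> 'cV[R]_m).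
Hypotheses (L_iid : iid P L) (Gam_iid : iid P Gam).
Hypothesis L_Gam_indep : independent2 P (sigma_process L) (sigma_process Gam).
Hypothesis Gam_L2 : forall t j, L2 P (fun w => Gam t w j 0).
Hypothesis Gam_mean0 : forall t j, \int[P]_w Gam t w j 0 = 0.
Variable S : seq 'M[R]_N.
Hypotheses (S_uniq : uniq S) (L_S : forall t w, L t w \in S).
Variables (Mt : nat -> 'M[R]_N -> 'M[R]_n) (B : 'M[R]_(n, m)) (a sigma2 : R).
Variables (e : nat -> Omega -> 'cV[R]_n) (e0 : 'cV[R]_n) (T : nat).
Hypothesis a_ge0 : 0 <= a.
Hypothesis e_init : forall w, e 0%N w = e0.
Hypothesis e_step : forall t w,
  e t.+1 w = Mt t (L t w) *m e t w + (alpha_wt a t *: B) *m Gam t w.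
Hypothesis noise_power : forall t, \int[P]_w sqnorm (B *m Gam t w) = sigma2.
Hypothesis path_contraction : forall t g v, (T <= t)%N -> g \in S ->
  sqnorm (Mt t g *m v) <= sqnorm v.
Hypothesis mean_contraction : forall t w, (T <= t)%N ->
  \sum_(g <- S) graph_prob P L g * sqnorm (Mt t g *m e t w) <=
  (1 - t.+1%:R^-1) * sqnorm (e t w).

Let alpha_ge0 t : 0 <= alpha_wt a t.
Proof. by rewrite divr_ge0. Qed.

Let e_L2 t i : L2 P (fun w => e t w i 0).
Proof. exact: (state_L2 L_iid Gam_L2 S_uniq L_S e_init e_step). Qed.

Let BGam_L2 t i : L2 P (fun w => (B *m Gam t w) i 0).
Proof. exact: linear_image_L2. Qed.

Let u t := \int[P]_w sqnorm (e t w).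

Let u_ge0 t : 0 <= u t.
Proof. by apply: Rintegral_ge0 => w _; exact: sqnorm_ge0. Qed.

Let sigma2_ge0 : 0 <= sigma2.
Proof. by rewrite -(noise_power 0); apply: Rintegral_ge0 => w _; exact: sqnorm_ge0. Qed.

Lemma mean_sqnorm_contraction t : (T <= t)%N ->
  u t.+1 <= (1 - t.+1%:R^-1) * u t + a ^+ 2 * sigma2 / t.+1%:R ^+ 2.
Proof.
move=> Tt; rewrite /u.
rewrite (mean_sqnorm_step L_iid Gam_iid L_Gam_indep Gam_L2 Gam_mean0 S_uniq L_S
  e_init e_step).
rewrite (mean_sqnorm_average L_iid Gam_L2 S_uniq L_S e_init e_step); apply: lerD.
  rewrite -RintegralZl //; last exact: sqnorm_L1.
  apply: le_Rintegral => //; last by move=> w _; exact: mean_contraction.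
    apply: L1_sum => g; apply: L1Z; apply: sqnorm_L1.
    exact: linear_image_L2.
  by apply: L1Z; exact: sqnorm_L1.
under eq_Rintegral do rewrite -scalemxAl sqnormZ.
rewrite RintegralZl //; last exact: sqnorm_L1.
by rewrite noise_power /alpha_wt expr_div_n mulrAC.
Qed.

Lemma enormZ k c (v : 'cV[R]_k) : 0 <= c -> enorm (c *: v) = c * enorm v.
Proof.
move=> c0; apply/eqP; rewrite -(@eqrXn2 _ 2) ?mulr_ge0 ?enorm_ge0 //.
by rewrite exprMn !enorm_sqr sqnormZ.
Qed.

Lemma enorm_step t w : (T <= t)%N ->
  enorm (e t.+1 w) <= enorm (e t w) + alpha_wt a t * enorm (B *m Gam t w).
Proof.
move=> Tt; rewrite e_step; apply: le_trans (enormD _ _) _.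
rewrite -scalemxAl enormZ // lerD2r -(@ler_pXn2r _ 2) ?nnegrE ?enorm_ge0 //.
by rewrite !enorm_sqr; exact: path_contraction.
Qed.

Let Z k w := block_energy (alpha_wt a) (fun s => enorm (B *m Gam s w))
  (fun s => enorm (e s w)) (k + T).+2.

Let Z_E k w : Z k w = sqnorm (e ((k + T).+2 ^ 4)%N w) +
  (((k + T).+3 ^ 4 - (k + T).+2 ^ 4)%:R) *
  \sum_((k + T).+2 ^ 4 <= s < (k + T).+3 ^ 4)
    alpha_wt a s ^+ 2 * sqnorm (B *m Gam s w).
Proof.
rewrite /Z /block_energy enorm_sqr; congr (_ + _ * _).
by apply: eq_bigr => s _; rewrite exprMn enorm_sqr.
Qed.

Let energy_L1 k : L1 P (fun w =>
  (((k + T).+3 ^ 4 - (k + T).+2 ^ 4)%:R) *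
  \sum_((k + T).+2 ^ 4 <= s < (k + T).+3 ^ 4)
    alpha_wt a s ^+ 2 * sqnorm (B *m Gam s w)).
Proof. by apply: L1Z; apply: L1_sum => s; apply: L1Z; exact: sqnorm_L1. Qed.

Let Z_L1 k : L1 P (Z k).
Proof.
rewrite (funext (Z_E k)).
by apply: L1D => //; exact: sqnorm_L1.
Qed.

(** The first two terms come from [contraction_rate4] at the start of a block; [225 = 15 ^ 2] comes
    from the block length, which enters twice. *)
Let D := T%:R * u T + 2 * (a ^+ 2 * sigma2) + 225 * (a ^+ 2 * sigma2).

Let integral_Z_le k : \int[P]_w Z k w <= D / k.+2%:R ^+ 2.
Proof.
under eq_Rintegral do rewrite Z_E.
rewrite RintegralD //; [|exact: sqnorm_L1|exact: energy_L1].
rewrite RintegralZl //; last first.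
  by apply: L1_sum => s; apply: L1Z; exact: sqnorm_L1.
rewrite integral_sum; last by move=> s; apply: L1Z; exact: sqnorm_L1.
set K := (k + T).+2.
have C0 : 0 <= a ^+ 2 * sigma2 by rewrite mulr_ge0 ?sqr_ge0.
have D0 : 0 <= D by rewrite !addr_ge0 ?mulr_ge0.
have kp : 0 < k.+2%:R :> R by [].
have Kp : 0 < K%:R :> R by [].
have kK : k.+2%:R <= K%:R :> R by rewrite ler_nat /K; lia.
apply: (@le_trans _ _ (D / K%:R ^+ 2)); last first.
  rewrite ler_wpM2l // lef_pV2 ?posrE ?exprn_gt0 //.
  by rewrite ler_pXn2r ?nnegrE ?ler0n.
rewrite mulrDl; apply: lerD.
  apply: (contraction_rate4 C0 (u_ge0 T) mean_sqnorm_contraction) => //.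
  by rewrite /K; lia.
have s_le : \sum_(K ^ 4 <= s < K.+1 ^ 4)
      \int[P]_w (alpha_wt a s ^+ 2 * sqnorm (B *m Gam s w)) <=
    \sum_(K ^ 4 <= s < K.+1 ^ 4) (a / K%:R ^+ 4) ^+ 2 * sigma2.
  rewrite big_nat [leRHS]big_nat; apply: ler_sum => s /andP[Ks _].
  rewrite RintegralZl //; last exact: sqnorm_L1.
  rewrite noise_power ler_wpM2r // ler_pXn2r ?nnegrE ?divr_ge0 ?exprn_ge0 //.
  rewrite ler_wpM2l // lef_pV2 ?posrE ?exprn_gt0 // -natrX ler_nat.
  exact: leqW.
(* One factor [15 * K ^ 3] is the Cauchy-Schwarz weight, the other counts the summands; each weight
   is at most [a / K ^ 4], which leaves order [1 / K ^ 2]. *)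
apply: (@le_trans _ _ ((15 * K%:R ^+ 3) *
    ((15 * K%:R ^+ 3) * ((a / K%:R ^+ 4) ^+ 2 * sigma2)))); last first.
  rewrite le_eqVlt; apply/orP; left; apply/eqP; field.
  by apply: lt0r_neq0.
have len : (K.+1 ^ 4 - K ^ 4)%:R <= 15 * K%:R ^+ 3 :> R.
  by rewrite -natrX -natrM ler_nat; exact: block_length_le.
apply: ler_pM => //.
  apply: sumr_ge0 => s _; apply: Rintegral_ge0 => w _.
  by rewrite mulr_ge0 ?sqr_ge0 ?sqnorm_ge0.
apply: le_trans s_le _; rewrite sumr_const_nat -[leLHS]mulr_natl.
by rewrite ler_wpM2r // mulr_ge0 ?sqr_ge0.
Qed.

(** The block energies have summable expectations, so they vanish in the limit almost surely;
    [enorm_step] then controls the times inside the blocks on each path. *)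
Theorem stochastic_approximation_cvg :
  {ae P, forall w, (fun t => sqnorm (e t w)) @ \oo --> (0 : R)}.
Proof.
have C0 : 0 <= a ^+ 2 * sigma2 by rewrite mulr_ge0 ?sqr_ge0.
have D0 : 0 <= D by rewrite !addr_ge0 ?mulr_ge0.
have : {ae P, forall w, Z ^~ w @ \oo --> (0 : R)}.
  apply: (@nonneg_series_ae_cvg0 _ _ _ P Z D) => //.
    move=> k w; rewrite Z_E addr_ge0 ?sqnorm_ge0 // mulr_ge0 //.
    by apply: sumr_ge0 => s _; rewrite mulr_ge0 ?sqr_ge0 ?sqnorm_ge0.
  move=> q; apply: (@le_trans _ _ (\sum_(k < q) D / k.+2%:R ^+ 2)).
    by apply: ler_sum => k _; exact: integral_Z_le.
  by rewrite -mulr_sumr ler_piMr //; exact: sum_inv_sqr_le.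
apply: filterS => w hZ.
have -> : (fun t => sqnorm (e t w)) = (fun t => enorm (e t w) ^+ 2).
  by apply/funext => t; rewrite enorm_sqr.
apply: (block_cvg0 (alpha := alpha_wt a)
  (b := fun s => enorm (B *m Gam s w)) (T := T)) => //.
- by move=> s; rewrite mulr_ge0 ?enorm_ge0.
- by move=> s; exact: enorm_ge0.
- by move=> s Ts; exact: enorm_step.
Qed.

End stochastic_approximation.

(** * Convergence set, noise and weights *)

Section column_convergence.
Context {R : realType} {n : nat}.

Lemma cvg_sqnorm (v : nat -> 'cV[R]_n) (l : 'cV[R]_n) :
  (fun t => sqnorm (v t - l)) @ \oo --> (0 : R) -> v @ \oo --> l.
Proof.
move=> /cvgr0Pnorm_lt h; apply/cvg_ballP => eps eps0.
have eps2 : 0 < eps ^+ 2 by rewrite exprn_gt0.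
apply: filterS (h _ eps2) => t ht; split=> // i j.
rewrite ord1 /ball /= -(@ltr_pXn2r _ 2) ?nnegrE ?(ltW eps0) //.
rewrite ger0_norm ?sqnorm_ge0 // in ht.
apply: le_lt_trans ht; rewrite real_normK ?num_real //.
rewrite sqnormE (bigD1 i) //= !mxE -sqrrN opprB lerDl.
by apply: sumr_ge0 => k _; exact: sqr_ge0.
Qed.

(** With the tolerances [1 / (k + 1)] only countably many conditions occur, which makes the
    convergence set measurable. *)
Lemma column_cvgP (v : nat -> 'cV[R]_n) (l : 'cV[R]_n) : v @ \oo --> l <->
  forall k, exists T, forall t, (T <= t)%N ->
    forall i, `|v t i 0 - l i 0| < k.+1%:R^-1.
Proof.
split=> [/cvg_ballP h k|h].
  have kp : 0 < k.+1%:R^-1 :> R by rewrite invr_gt0.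
  have [T _ hT] := h _ kp; exists T => t Tt i.
  by have [_ /(_ i 0)] := hT t Tt; rewrite /ball /= distrC.
apply/cvg_ballP => eps eps0.
have [k hk] : exists k : nat, k.+1%:R^-1 < eps.
  exists (Num.truncn eps^-1); rewrite invf_plt ?posrE //.
  exact: truncnS_gt.
have [T hT] := h k; exists T => // t /= Tt; split=> // i j.
by rewrite ord1 /ball /= distrC; apply: lt_trans (hT _ Tt _) hk.
Qed.

Lemma measurable_column_cvg (d : measure_display) (Omega : measurableType d)
    (v : nat -> Omega -> 'cV[R]_n) (l : 'cV[R]_n) :
  (forall t i, measurable_fun setT (fun w => v t w i 0)) ->
  measurable [set w | (fun t => v t w) @ \oo --> l].
Proof.
move=> mv.
rewrite (_ : [set w | _] = \bigcap_k \bigcup_T \bigcap_(t in [set t | (T <= t)%N])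
    \bigcap_(i in [set: 'I_n]) [set w | `|v t w i 0 - l i 0| < k.+1%:R^-1]).
  apply: bigcapT_measurable => k; apply: bigcupT_measurable => T.
  apply: bigcap_measurableType => t _.
  apply: fin_bigcap_measurable => [|i _]; first exact: finite_finset.
  rewrite -[X in measurable X]setTI; apply: measurable_fun_ltr => //.
  by apply: measurableT_comp => //; apply: measurable_funB.
apply/seteqP; split=> w /=.
  by move/column_cvgP => h k _; have [T hT] := h k; exists T => // t Tt i _; exact: hT.
move=> h; apply/column_cvgP => k; have [T _ hT] := h k Logic.I.
by exists T => t Tt i; exact: hT.
Qed.

End column_convergence.

(** * The finitely many values of a graph Laplacian *)

Section laplacian_values.
Context {R : realType} {N : nat}.

(** All boolean relations are enumerated, not only symmetric irreflexive ones, so the list contains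
    every Laplacian and possibly other matrices. *)
Definition laplacians : seq 'M[R]_N :=
  undup [seq (let e := (fun i j => f (i, j)) : rel 'I_N in
              degree_mx e - adjacency_mx e) | f : {ffun 'I_N * 'I_N -> bool}].

Lemma is_laplacian_mem A : is_laplacian A -> A \in laplacians.
Proof.
move=> [e [_ _ ->]]; rewrite mem_undup; apply/mapP.
exists [ffun ij => e ij.1 ij.2]; first by rewrite mem_enum.
suff <- : e = (fun i j => [ffun ij => e ij.1 ij.2] (i, j)) by [].
by apply/funext => i; apply/funext => j; rewrite ffunE.
Qed.

End laplacian_values.

(** * Second moments of the noise *)

Section noise.
Context {d : measure_display} {Omega : measurableType d} {R : realType}.
Variable P : probability Omega R.
Context {m : nat}.
Variables (X : Omega -> 'cV[R]_m) (C : 'M[R]_m).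
Hypothesis mX : forall i, measurable_fun setT (fun w => X w i 0).
Hypothesis X_mean0 : forall i, 'E_P[fun w => (X w i 0)%R]%E = 0%E.
Hypothesis X_cov : has_covariance P X C.

Lemma mean0_integral i : \int[P]_w X w i 0 = 0.
Proof. by have := X_mean0 i; rewrite unlock /Rintegral => ->. Qed.

Let covE i j : (\int[P]_w (X w i 0 * X w j 0)%:E)%E = (C i j)%:E.
Proof.
rewrite -X_cov covariance.unlock !X_mean0 /= expectation.unlock.
by apply: eq_integral => w _; rewrite fctE /= !subr0.
Qed.

(** The covariance is a real number inside [\bar R]; with zero mean, its diagonal entry is the
    integral of the square, which is therefore finite. *)
Lemma finite_covariance_L2 i : L2 P (fun w => X w i 0).
Proof.
split=> //; apply/integrableP; split.
  by apply/measurable_EFinP; exact: measurable_funX.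
rewrite (_ : (\int[P]_x _)%E = (C i i)%:E) ?ltry // -covE.
apply: eq_integral => w _ /=.
by rewrite ger0_norm ?sqr_ge0 // expr2.
Qed.

Lemma integral_covariance i j : \int[P]_w (X w i 0 * X w j 0) = C i j.
Proof. by rewrite /Rintegral covE. Qed.

(** The quadratic form at [v] is the expectation of the square of the linear combination of the
    [X w i 0] with coefficients [v i 0]. *)
Lemma covariance_psd : psd C.
Proof.
split.
  apply/matrixP => i j; rewrite mxE; apply: EFin_inj.
  by rewrite -!X_cov covarianceC.
move=> v; have lX := finite_covariance_L2.
have -> : quad C v =
    \int[P]_w ((\sum_i v i 0 * X w i 0) * (\sum_j v j 0 * X w j 0)).
  rewrite integral_bilinear // quad_dot dotE; apply: eq_bigr => i _.
  rewrite mxE mulr_sumr; apply: eq_bigr => j _.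
  by rewrite integral_covariance; ring.
by apply: Rintegral_ge0 => w _; rewrite -expr2 sqr_ge0.
Qed.

Lemma noise_power k (A : 'M[R]_(k, m)) :
  \int[P]_w sqnorm (A *m X w) = \tr (A *m C *m A^T).
Proof.
have lX := finite_covariance_L2; have lA := linear_image_L2 A lX.
under eq_Rintegral do rewrite /sqnorm dotE.
rewrite integral_sum; last by move=> i; exact: L2_L1M.
rewrite /mxtrace; apply: eq_bigr => i _; under eq_Rintegral do rewrite mxE.
rewrite integral_bilinear // -mulmxA mxE; apply: eq_bigr => j _.
rewrite mxE mulr_sumr; apply: eq_bigr => l _.
by rewrite integral_covariance mxE; ring.
Qed.

End noise.

(** * Comparison and decay of the weights *)

Section weights.
Context {R : realType}.

Lemma alpha_le_beta (a beta0 delta1 : R) t : 0 < a -> 0 < beta0 -> delta1 <= 1 ->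
  alpha_wt a t * (beta0 / a) <= beta_wt beta0 delta1 t.
Proof.
move=> a0 b0 d1; rewrite /alpha_wt /beta_wt.
have tp : 0 < t.+1%:R :> R by [].
rewrite (_ : _ * _ = beta0 / t.+1%:R); last by field; rewrite ?gt_eqF.
rewrite ler_wpM2l ?(ltW b0) // lef_pV2 ?posrE ?powR_gt0 //.
by rewrite -[leRHS]powRr1 ?ler0n // ler_powR // ler1n.
Qed.

Lemma beta_wt_small (beta0 delta1 C : R) : 0 < beta0 -> 0 < delta1 -> 0 <= C ->
  exists T, forall t, (T <= t)%N -> beta_wt beta0 delta1 t * C <= 1.
Proof.
move=> b0 d0 C0; have bC : 0 <= beta0 * C by rewrite mulr_ge0 // ltW.
(* The condition to meet is [beta0 * C <= (t + 1) ^ delta1]; the [+ 1] makes up for the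
   truncation. *)
exists (Num.truncn ((beta0 * C) `^ delta1^-1)) => t Tt.
rewrite /beta_wt mulrAC ler_pdivrMr ?powR_gt0 // mul1r.
have -> : beta0 * C = ((beta0 * C) `^ delta1^-1) `^ delta1.
  by rewrite -powRrM mulVf ?gt_eqF // powRr1.
rewrite ge0_ler_powR ?nnegrE ?(ltW d0) ?powR_ge0 //.
by apply: le_trans (ltW (truncnS_gt _)) _; rewrite ler_nat.
Qed.

End weights.

(** * Convergence of the estimates *)

Theorem mainTheorem1 (R : realType) (d : measure_display)
  (Omega : measurableType d) (P : probability Omega R)
  (N : nat) (theta : 'cV[R]_N)
  (* sensing model *)
  (M : 'I_N -> nat) (H : forall n : 'I_N, 'M[R]_(M n, N))
  (Rc : forall n : 'I_N, 'M[R]_(M n))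
  (gamma y : forall n : 'I_N, nat -> Omega -> 'cV[R]_(M n))
  (hobs : forall n t w, y n t w = H n *m theta + gamma n t w)
  (hgamma_iid : iid P (fun t w => \mxcol_(n < N) gamma n t w))
  (hgamma_mean : forall n t, has_mean P (gamma n t) 0)
  (hgamma_cov :
     forall t, has_covariance P (fun w => \mxcol_(n < N) gamma n t w) (Rmx Rc))
  (hRc : forall n, Rc n \in unitmx)
  (* communication *)
  (L : nat -> Omega -> 'M[R]_N)
  (hL_lap : forall t w, is_laplacian (L t w))
  (hL_iid : iid P L)
  (hL_indep : independent2 P (sigma_process L)
     (sigma_process (fun t w => \mxcol_(n < N) gamma n t w)))
  (Lbar : 'M[R]_N) (hLbar : forall t, has_mean P (L t) Lbar)
  (* interest sets *)
  (I : 'I_N -> {set 'I_N})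
  (hI : forall n, I n != finset.set0)
  (hItilde : forall n, nonzero_cols H n != finset.set0)
  (LPbar : 'M[R]_(\sum_(n < N) N))
  (hLPbar : forall t, has_mean P (fun w => LP I (L t w)) LPbar)
  (* weights and constants *)
  (a beta0 delta1 eps1 c1 : R)
  (ha : 0 < a) (hbeta0 : 0 < beta0) (heps1 : 0 < eps1) (hc1 : 0 < c1)
  (hdelta1 : 0 < delta1) (hdelta1' : delta1 < 1 / 2 - 1 / (2 + eps1))
  (* assumptions *)
  (A1 : forall n t,
     ('E_P[fun w => (enorm (gamma n t w) `^ (2 + eps1))%R] < +oo)%E)
  (A2 : \rank (Gmx H Rc) = N)
  (A3 : forall n, nonzero_cols H n \subset I n)
  (A4 : 0 < lambda2 Lbar)
  (A5 : forall v : 'cV[R]_(\sum_(n < N) N), (exists u, v = Pmx I *m u) ->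
     c1 * enorm v ^+ 2 <=
     quad ((beta0 / alpha_wt a 0) *: LPbar
           + Pmx I *m GH H *m invmx (Rmx Rc) *m (GH H)^T *m Pmx I) v)
  (A6 : 1 <= a * Num.min (lambda_min (GPmx H Rc I)) (Num.min c1 beta0^-1))
  (* algorithm *)
  (x : nat -> Omega -> 'cV[R]_(\sum_(n < N) N))
  (x0 : 'cV[R]_(\sum_(n < N) N)) (hx0 : x0 = Pmx I *m x0)
  (hx_init : forall w, x 0%N w = x0)
  (hx_step : forall t w, x t.+1 w =
     x t w - beta_wt beta0 delta1 t *: (LP I (L t w) *m x t w)
     + alpha_wt a t *: (Pmx I *m GH H *m invmx (Rmx Rc)
         *m ((\mxcol_(n < N) y n t w) - (GH H)^T *m Pmx I *m x t w))) :
  P [set w | (fun t => x t w) @ \oo --> Pmx I *m ones_kron theta] = 1%E.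
Proof.
pose Gam t w := \mxcol_(n < N) gamma n t w.
pose xs := Pmx I *m ones_kron theta.
pose B := Pmx I *m GH H *m invmx (Rmx Rc).
pose K := B *m (GH H)^T *m Pmx I.
pose beta := beta_wt beta0 delta1; pose alpha := alpha_wt a.
pose A t g := beta t *: LP I g + alpha t *: K.
(* The error is introduced through an existential so that its body stays hidden. *)
have [e eE] : exists e : nat -> Omega -> 'cV[R]_(\sum_(n < N) N),
    forall t w, e t w = x t w - xs by exists (fun t w => x t w - xs).
have alpha0 t : 0 <= alpha t by rewrite /alpha /alpha_wt divr_ge0 // ltW.
have beta0' t : 0 <= beta t by rewrite /beta /beta_wt divr_ge0 ?powR_ge0 // ltW.
have delta_le1 : delta1 <= 1.
  have : 0 < 1 / (2 + eps1) by rewrite divr_gt0 //; lra.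
  lra.
have mGam t i : measurable_fun setT (fun w => Gam t w i 0).
  by have [rG _ _] := hgamma_iid; exact: (random_mx_entry (X := Gam) i 0 (rG t)).
have Gam_mean t i : 'E_P[fun w => (Gam t w i 0)%R]%E = 0%E.
  rewrite (_ : (fun w => _) =
      (fun w => gamma (tagnat.sig1 i) t w (tagnat.sig2 i) 0)).
    by rewrite hgamma_mean mxE.
  by apply/funext => w; rewrite mxE.
have Gam_L2 t i := finite_covariance_L2 (mGam t) (Gam_mean t) (hgamma_cov t) i.
have Gam_mean0 t i := mean0_integral (Gam_mean t) i.
have psdR : psd (Rmx Rc).
  exact: (covariance_psd (mGam 0%N) (Gam_mean 0%N) (hgamma_cov 0%N)).
have psdK : psd K.
  have := psd_conj (Pmx I *m GH H) (psd_invmx psdR).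
  by rewrite trmx_mul tr_Pmx !mulmxA.
have HP : (GH H)^T *m Pmx I = (GH H)^T by exact: trGH_Pmx.
(* The consensus term annihilates the target, and the observation minus its prediction at the target
   is pure noise. *)
have e_step t w :
    e t.+1 w = (1%:M - A t (L t w)) *m e t w + (alpha t *: B) *m Gam t w.
  have xE : x t w = e t w + xs by rewrite eE subrK.
  have LPx : LP I (L t w) *m x t w = LP I (L t w) *m e t w.
    by rewrite xE mulmxDr LP_Pmx_ones addr0.
  have yE : \mxcol_(n < N) y n t w = (GH H)^T *m Pmx I *m xs + Gam t w.
    rewrite -mulmxA [Pmx I *m xs]mulmxA Pmx_idem mulmxA HP trGH_mxcol -mxcolD.
    by apply/eq_mxcol => n; exact: hobs.
  have yx : \mxcol_(n < N) y n t w - (GH H)^T *m Pmx I *m x t w =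
      Gam t w - (GH H)^T *m Pmx I *m e t w.
    by rewrite yE xE mulmxDr opprD [_ *m xs + _]addrC addrACA subrr addr0.
  rewrite eE hx_step LPx yx -/B addrAC [x t w - _ - xs]addrAC -eE.
  rewrite mulmxBl mul1mx /A mulmxDl -!scalemxAl opprD -!addrA; congr (_ + (_ + _)).
  by rewrite mulmxBr scalerBr addrC !mulmxA.
(* The error stays in the range of the projection, the only place where A5 gives coercivity. *)
have Pe t w : Pmx I *m e t w = e t w.
  elim: t => [|t ih].
    by rewrite eE hx_init mulmxBr -hx0 /xs mulmxA Pmx_idem.
  have PB : Pmx I *m B = B by rewrite /B !mulmxA Pmx_idem.
  have PK : Pmx I *m K = K by rewrite /K mulmxA [Pmx I *m (B *m _)]mulmxA PB.
  have PA : Pmx I *m A t (L t w) = A t (L t w).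
    by rewrite /A mulmxDr -!scalemxAr Pmx_LP PK.
  rewrite e_step mulmxDr !mulmxA -scalemxAr PB mulmxBr mulmx1 PA.
  by rewrite !mulmxBl mul1mx ih.
(* Filtering keeps genuine Laplacians only, so that [psd_LP] applies to every listed value. *)
pose Slap : seq 'M[R]_N := [seq g <- laplacians | `[< is_laplacian g >]].
have S_uniq : uniq Slap by rewrite filter_uniq // undup_uniq.
have L_S t w : L t w \in Slap.
  by rewrite mem_filter is_laplacian_mem // andbT; apply/asboolP.
have Slap_lap g : g \in Slap -> is_laplacian g.
  by rewrite mem_filter => /andP[/asboolP].
pose p g := graph_prob P L g.
have LPbarE : LPbar = \sum_(g <- Slap) p g *: LP I g.
  apply/matrixP => i j; have := hLPbar 0%N i j; rewrite expectation.unlock => hij.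
  rewrite summxE; transitivity (\sum_(g <- Slap) p g * LP I g i j); last first.
    by apply: eq_bigr => g _; rewrite [RHS]mxE.
  rewrite -(graph_prob_sum hL_iid S_uniq L_S (fun g => LP I g i j) 0%N).
  by rewrite /Rintegral hij.
have quadLPbar v : quad LPbar v = \sum_(g <- Slap) p g * quad (LP I g) v.
  by rewrite LPbarE quad_sum; apply: eq_bigr => g _; rewrite quadZ.
have p0 g : 0 <= p g by exact: graph_prob_ge0.
have sump : \sum_(g <- Slap) p g = 1 by exact: (graph_prob_sum1 hL_iid S_uniq L_S).
pose CL := \sum_(g <- Slap) mx_bound (LP I g).
have CL0 : 0 <= CL by apply: sumr_ge0 => g _; exact: mx_bound_ge0.
(* From [T] on [A t g] is at most the identity: [CL] bounds every graph term, and
   [alpha t <= beta t * (a / beta0)] lets [beta t] absorb the term with [K]. *)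
have [T hT] : exists T, forall t, (T <= t)%N ->
    beta t * (CL + a / beta0 * mx_bound K) <= 1.
  apply: beta_wt_small => //; apply: addr_ge0 => //.
  by rewrite mulr_ge0 ?mx_bound_ge0 // divr_ge0 // ltW.
have ab t : alpha t * (beta0 / a) <= beta t by exact: alpha_le_beta.
have ab' t : alpha t <= beta t * (a / beta0).
  have -> : alpha t = alpha t * (beta0 / a) * (a / beta0).
    by field; rewrite !gt_eqF.
  by rewrite ler_wpM2r // divr_ge0 // ltW.
have A_psd t g : g \in Slap -> psd (A t g).
  move=> gS; apply: psd_add; apply: psd_scale => //; apply: psd_LP;
   exact: Slap_lap.
have A_le t g v : (T <= t)%N -> g \in Slap -> quad (A t g) v <= sqnorm v.
  move=> Tt gS; rewrite quadD !quadZ -[leRHS]mul1r.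
  apply: le_trans (ler_wpM2r (sqnorm_ge0 v) (hT t Tt)).
  rewrite mulrDr mulrDl; apply: lerD.
    rewrite -[beta t * CL * _]mulrA; apply: ler_wpM2l => //.
    apply: le_trans (quad_le_bound _ _) _; apply: ler_wpM2r; first exact: sqnorm_ge0.
    rewrite /CL (bigD1_seq g) //= lerDl.
    by apply: sumr_ge0 => ? _; exact: mx_bound_ge0.
  apply: (@le_trans _ _ (alpha t * (mx_bound K * sqnorm v))).
    by apply: ler_wpM2l => //; exact: quad_le_bound.
  rewrite [beta t * _]mulrA -[leRHS]mulrA; apply: ler_wpM2r => //.
  by rewrite mulr_ge0 ?mx_bound_ge0 ?sqnorm_ge0.
have contract t g v : (T <= t)%N -> g \in Slap ->
    sqnorm ((1%:M - A t g) *m v) <= sqnorm v - quad (A t g) v.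
  move=> Tt gS; rewrite mulmxBl mul1mx; apply: psd_contract; first exact: A_psd.
  by move=> v'; exact: A_le.
have ac1 : 1 <= a * c1.
  apply: le_trans A6 _; rewrite ler_wpM2l ?(ltW ha) //.
  by rewrite !ge_min lexx orbT.
(* As [LPbar] is nonnegative, [beta t] may be lowered to [alpha t * (beta0 / a)], the proportion in
   A5. Then A5 bounds the mean decrease below by [alpha t * c1] times the squared norm, and
   [1 <= a * c1] makes this at least [1 / (t + 1)] of it. *)
have mean_contract t w : (T <= t)%N ->
    \sum_(g <- Slap) p g * sqnorm ((1%:M - A t g) *m e t w) <=
    (1 - t.+1%:R^-1) * sqnorm (e t w).
  move=> Tt; set v := e t w.
  apply: (@le_trans _ _ (\sum_(g <- Slap) p g * (sqnorm v - quad (A t g) v))).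
    rewrite big_seq [leRHS]big_seq; apply: ler_sum => g gS.
    by rewrite ler_wpM2l //; exact: contract.
  have -> : \sum_(g <- Slap) p g * (sqnorm v - quad (A t g) v) =
      sqnorm v - beta t * quad LPbar v - alpha t * quad K v.
    rewrite quadLPbar mulr_sumr -[sqnorm v in RHS]mul1r -[alpha t * _]mul1r -sump.
    rewrite !mulr_suml -!sumrB; apply: eq_bigr => g _.
    by rewrite quadD !quadZ; ring.
  have hA5 := A5 v (ex_intro _ v (esym (Pe t w))).
  have alpha0E : alpha_wt a 0 = a by rewrite /alpha_wt divr1.
  rewrite quadD quadZ alpha0E -/B -/K enorm_sqr in hA5.
  have qL : 0 <= quad LPbar v.
    rewrite quadLPbar big_seq; apply: sumr_ge0 => g gS; rewrite mulr_ge0 //.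
    by have [_] := psd_LP I (Slap_lap _ gS); exact.
  have h1 := ler_wpM2l (alpha0 t) hA5.
  have h2 := ler_wpM2r qL (ab t).
  have h3 : t.+1%:R^-1 * sqnorm v <= alpha t * (c1 * sqnorm v).
    rewrite mulrA ler_wpM2r ?sqnorm_ge0 // /alpha /alpha_wt mulrAC -[leLHS]mul1r.
    by rewrite ler_wpM2r // invr_ge0.
  rewrite mulrDr [alpha t * (_ * quad _ _)]mulrA in h1.
  rewrite mulrBl mul1r; move: h1 h2 h3.
  move: (alpha t * (c1 * _)) (alpha t * quad K v) (beta t * _) (_ * quad LPbar v).
  by move: (_ * sqnorm v) => *; lra.
have noise t : \int[P]_w sqnorm (B *m Gam t w) = \tr (B *m Rmx Rc *m B^T).
  exact: (noise_power (mGam t) (Gam_mean t) (hgamma_cov t)).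
have e_init w : e 0%N w = x0 - xs by rewrite eE hx_init.
have path_contract t g v : (T <= t)%N -> g \in Slap ->
    sqnorm ((1%:M - A t g) *m v) <= sqnorm v.
  move=> Tt gS; apply: le_trans (contract t g v Tt gS) _; rewrite gerBl.
  by have [_] := A_psd t g gS; exact.
have ae_cvg := stochastic_approximation_cvg hL_iid hgamma_iid hL_indep Gam_L2
  Gam_mean0 S_uniq L_S (ltW ha) e_init e_step noise path_contract mean_contract.
(* An almost sure statement only says that the exceptional set is negligible; measurability turns
   this into a probability equal to one. *)
have mE : measurable [set w | (fun t => x t w) @ \oo --> xs].
  apply: measurable_column_cvg => t i.
  rewrite (_ : (fun w => _) = (fun w => e t w i 0 + xs i 0)); last first.
    by apply/funext => w; rewrite eE !mxE subrK.
  apply: measurable_funD => //.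
  by have [] := state_L2 (Mt := fun t g => 1%:M - A t g) hL_iid Gam_L2 S_uniq L_S
    e_init e_step t i.
have nullC : P (~` [set w | (fun t => x t w) @ \oo --> xs]) = 0%E.
  apply/negligibleP; first exact: measurableC.
  apply: negligibleS ae_cvg => w /= nx hw; apply: nx.
  by apply: cvg_sqnorm; under eq_fun do rewrite -eE.
rewrite probability_setC // in nullC; move: nullC; rewrite -/xs => /eqP.
by rewrite sube_eq ?fin_num_measure // add0e eq_sym => /eqP.
Qed.
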